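(* Let $(x_k,\lambda_k)_{k\ge0}$ and $(\overline x_k,\overline\lambda_k)_{k\ge0}$ be generated, from some $(x_0,\lambda_0)\in\mathcal H\times\mathcal G$, for every $k\ge0$ by $$\begin{aligned}\overline x_k&=\operatorname{prox}_{s(f+\varepsilon_k\hat h)}\bigl(x_k-s(\nabla m(x_k)+A^*\lambda_k+\varepsilon_k\nabla h(x_k))\bigr),\\ \overline\lambda_k&=\operatorname{prox}_{sg^*}(\lambda_k+sAx_k),\\ x_{k+1}&=\operatorname{prox}_{s(f+\varepsilon_k\hat h)}\bigl(x_k-s(\nabla m(\overline x_k)+A^*\overline\lambda_k+\varepsilon_k\nabla h(\overline x_k))\bigr),\\ \lambda_{k+1}&=\operatorname{prox}_{sg^*}(\lambda_k+sA\overline x_k),\end{aligned}$$ with $0<s<\frac1{\sqrt2(L_{\nabla m}+\|A\|)}$. Let $(\xi_{f,k},\xi_{g^*,k})_{k\ge1}$ be as defined in the context and let $(x^*,\lambda^* )$ be an optimal solution of the bilevel problem of minimizing $\boldsymbol H$ over $\operatorname{zer}(\boldsymbol V+\partial\hat{\boldsymbol f})$. Write $$r_k:=\|\xi_{f,k}+A^*\lambda_k+\nabla m(x_k)\|,\quad d_k:=\|\xi_{g^*,k}-Ax_k\|,$$ $$e_k:=\bigl|f(x_k)+g(\xi_{g^*,k})+m(x_k)-(f(x^* )+g(Ax^* )+m(x^* ))\bigr|.$$ Then $\operatorname{dist}(0,\partial f(x_k)+A^*\lambda_k+\nabla m(x_k))\le r_k$ and $\operatorname{dist}(0,\partial g^*(\lambda_k)-Ax_k)\le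 d_k$ for $k\geq 1$, and the following hold as $k\to+\infty$. (i) If $\boldsymbol V+\partial\hat{\boldsymbol f}$ satisfies the discrete Attouch--Czarnecki-type condition and $\delta>\frac12$, then $r_k=o\left(\frac1{\sqrt k}\right)$, $d_k=o\left(\frac1{\sqrt k}\right)$ and $e_k=o\left(\frac1{\sqrt k}\right)$. (ii) If $\boldsymbol V+\partial\hat{\boldsymbol f}$ satisfies the discrete Attouch--Czarnecki-type condition and $\delta=\frac12$, then $r_k=\mathcal O\left(\frac1{\sqrt k}\right)$, $d_k=\mathcal O\left(\frac1{\sqrt k}\right)$, $e_k=\mathcal O\left(\frac1{\sqrt k}\right)$ and $H(x_k)\to H(x^* )$. Furthermore, $(x_k,\lambda_k)$ converges weakly to an optimal solution of the bilevel problem. (iii) If $\boldsymbol V+\partial\hat{\boldsymbol f}$ satisfies the sharpness condition with exponent $\rho\in(1,2)$ and $\frac1{\rho^*}<\delta<\frac12$, where $\frac1\rho+\frac1{\rho^*}=1$, then $r_k=\mathcal O\left(\frac1{k^\delta}\right)$, $d_k=\mathcal O\left(\frac1{k^\delta}\right)$, $e_k=\mathcal O\left(\frac1{k^\delta}\right)$ and $|H(x_k)-H(x^* )|=o\left(\frac1{k^{\frac12-\delta}}\right)$. Furthermore, $(x_k,\lambda_k)$ converges weakly to an optimal solution of the bilevel problem.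
   Context: $\mathcal H,\mathcal G$ are real Hilbert spaces; $h,m:\mathcal H\to\mathbb R$ are convex and continuously Fréchet differentiable with $\nabla h$ being $L_{\nabla h}$-Lipschitz and $\nabla m$ being $L_{\nabla m}$-Lipschitz, $L_{\nabla h},L_{\nabla m}>0$; $f,\hat h:\mathcal H\to\overline{\mathbb R}$ and $g:\mathcal G\to\overline{\mathbb R}$ are proper, convex, lower semicontinuous, $g^*$ is the Fenchel conjugate of $g$; $A:\mathcal H\to\mathcal G$ is linear continuous with adjoint $A^*$. $H:=h+\hat h$. Constants $c,a,\delta>0$ are fixed and $\varepsilon_k:=\frac c{(k+a)^\delta}$. $\operatorname{prox}_\varphi(z)$ is the unique minimizer of $u\mapsto\varphi(u)+\frac12\|u-z\|^2$. On $\mathcal H\times\mathcal G$ define $\boldsymbol h(x,\lambda)=h(x)$, $\hat{\boldsymbol h}(x,\lambda)=\hat h(x)$, $\boldsymbol H=\boldsymbol h+\hat{\boldsymbol h}$, $\boldsymbol V(x,\lambda)=(\nabla m(x)+A^*\lambda,-Ax)$, $\hat{\boldsymbol f}(x,\lambda)=f(x)+g^*(\lambda)$, and $\boldsymbol Z:=\operatorname{zer}(\boldsymbol V+\partial\hat{\boldsymbol f})$, i.e. the set of $(x,\lambda)$ with $0\in\partial f(x)+A^*\lambda+\nabla m(x)$ and $Ax\in\partial g^*(\lambda)$. The bilevel problem is to minimize $\boldsymbol H(x,\lambda)=h(x)+\hat h(x)$ over $\boldsymbol Z$; its optimal solutions are the minimizers of $\boldsymbol H$ over $\boldsymbol Z$.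 Standing assumptions: $\partial(\hat{\boldsymbol f}+\varepsilon_k\hat{\boldsymbol h})=\partial\hat{\boldsymbol f}+\varepsilon_k\partial\hat{\boldsymbol h}$ for every $k\ge0$; for every optimal solution $z^*$ of the bilevel problem, $0\in\partial\boldsymbol H(z^* )+N_{\boldsymbol Z}(z^* )$, where $N_{\boldsymbol Z}(z^* )=\{p:\langle p,z-z^*\rangle\le0\ \forall z\in\boldsymbol Z\}$; $\partial\hat{\boldsymbol h}$ maps bounded subsets of its domain to bounded sets. For $k\ge0$ the definition of the prox gives $$\frac{x_k-x_{k+1}-s(\nabla m(\overline x_k)+A^*\overline\lambda_k+\varepsilon_k\nabla h(\overline x_k))}{s}=\xi_{f,k+1}+\varepsilon_k\xi_{\hat h,k+1},\qquad \frac{\lambda_k-\lambda_{k+1}+sA\overline x_k}{s}=\xi_{g^*,k+1},$$ with $\xi_{f,k+1}\in\partial f(x_{k+1})$, $\xi_{\hat h,k+1}\in\partial\hat h(x_{k+1})$, $\xi_{g^*,k+1}\in\partial g^*(\lambda_{k+1})$; this defines $\xi_{f,k},\xi_{g^*,k}$ for $k\ge1$. For an optimal solution $z^*=(x^*,\lambda^* )$ let $\boldsymbol F(z):=\langle z-z^*,\boldsymbol V(z)\rangle+\hat{\boldsymbol f}(z)-\hat{\boldsymbol f}(z^* )$, $\boldsymbol F^*$ its Fenchel conjugate and $\sigma_{\boldsymbol Z}(u)=\sup_{z\in\boldsymbol Z}\langle z,u\rangle$. Discrete Attouch--Czarnecki-type condition: for every optimal solution $z^*$ and every $p^*\in N_{\boldsymbol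 Z}(z^* )$, $\sum_{k=0}^{+\infty}\bigl[\boldsymbol F^*(\varepsilon_kp^* )-\sigma_{\boldsymbol Z}(\varepsilon_kp^* )\bigr]<+\infty$. Sharpness condition with exponent $\rho\in(1,2)$: for every optimal solution $z^*$ there exists $\tau>0$ such that $\frac\tau\rho\operatorname{dist}(z,\boldsymbol Z)^\rho\le\boldsymbol F(z)$ for all $z\in\mathcal H\times\mathcal G$. *)

(* Defs.v *)
From HB Require Import structures.
From mathcomp Require Import all_boot all_order all_algebra.
From mathcomp Require Import all_classical all_reals all_analysis.

Set Implicit Arguments.
Unset Strict Implicit.
Unset Printing Implicit Defensive.

Import Order.TTheory GRing.Theory Num.Theory.
Import numFieldNormedType.Exports.

Local Open Scope classical_set_scope.
Local Open Scope ring_scope.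

HB.mixin Record Lmodule_isInner (R : realType) V & GRing.Lmodule R V := {
  inner : {dot V for (@idfun R)} }.

#[short(type="innerType")]
HB.structure Definition Inner (R : realType) :=
  {V of GRing.Lmodule R V & Lmodule_isInner R V}.

Notation "''[' u , v ]" := (inner u v) : ring_scope.

HB.mixin Record Inner_isHilbert (R : realType) V
    & CompleteNormedModule R V & Inner R V := {
  inner_norm : forall x : V, '[x, x] = `|x| ^+ 2 }.

#[short(type="hilbertType")]
HB.structure Definition Hilbert (R : realType) :=
  {V of CompleteNormedModule R V & Inner R V & Inner_isHilbert R V}.

(* The library norms a product of normed modules by the maximum of the norms,
   so H * G is not declared a hilbertType. It only receives the inner product
   below; the Hilbert norm on it is [inorm]. *)
Section prod_inner.
Context {R : realType} {H G : innerType R}.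

Definition prod_inner (z w : H * G) : R := '[z.1, w.1] + '[z.2, w.2].

Let prod_inner_bilinear :
  bilinear_for *%R ((@idfun R) \; *%R) prod_inner.
Proof.
split=> [u|u] a x y; rewrite /prod_inner /=.
- by rewrite !linearDl !linearZl_LR /= mulrDr !addrA; congr (_ + _);
     rewrite -!addrA; congr (_ + _); rewrite addrC.
- by rewrite !linearD !linearZ /= mulrDr !addrA; congr (_ + _);
     rewrite -!addrA; congr (_ + _); rewrite addrC.
Qed.

HB.instance Definition _ := bilinear_isBilinear.Build R (H * G)%type (H * G)%type
  R *%R ((@idfun R) \; *%R) prod_inner prod_inner_bilinear.

Let prod_inner_sym (z w : H * G) :
  prod_inner z w = (-1) ^+ false * idfun (prod_inner w z).
Proof.
by rewrite /prod_inner expr0 mul1r /= (hermC inner z.1) (hermC inner z.2)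
     !expr0 !mul1r.
Qed.

HB.instance Definition _ := isHermitianSesquilinear.Build R (H * G)%type
  false (@idfun R) prod_inner prod_inner_sym.

Let dot_ge0 (V : innerType R) (x : V) : 0 <= '[x, x].
Proof.
have [->|x0] := eqVneq x 0; first by rewrite linear0l.
exact/ltW/neq0_dnorm_gt0.
Qed.

Let prod_inner_gt0 (z : H * G) : z != 0 -> 0 < prod_inner z z.
Proof.
case: z => x y; rewrite /prod_inner /= => xy0.
have [x0|x0] := eqVneq x 0; last first.
  by rewrite ltr_wpDr// ?dot_ge0// neq0_dnorm_gt0.
rewrite ltr_wpDl// ?dot_ge0// neq0_dnorm_gt0//.
by apply: contraNneq xy0 => ->; rewrite x0.
Qed.

HB.instance Definition _ :=
  isDotProduct.Build R (H * G)%type prod_inner prod_inner_gt0.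

HB.instance Definition _ := Lmodule_isInner.Build R (H * G)%type prod_inner.

Lemma prod_innerE (z w : H * G) : '[z, w] = '[z.1, w.1] + '[z.2, w.2].
Proof. by []. Qed.

End prod_inner.

Section convex_analysis.
Context {R : realType} {V : innerType R}.
Implicit Types (f : V -> \bar R) (S : set V) (z u : V).

Definition inorm z : R := Num.sqrt '[z, z].

(* idist z set0 = +oo *)
Definition idist z S : \bar R := ereal_inf [set (inorm (z - w))%:E | w in S].

Definition eproper f : Prop :=
  (forall z, f z != -oo%E) /\ (exists z, f z \is a fin_num).

(* Meant for functions that do not take the value -oo; recall that
   0 * +oo = 0 in \bar R. *)
Definition econvex f : Prop := forall (x y : V) (t : R), 0 <= t <= 1 ->
  (f (t *: x + (1 - t) *: y)%R <= t%:E * f x + (1 - t)%:E * f y)%E.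

(* Empty wherever f is not finite. *)
Definition subdiff f : V -> set V := fun z => [set p |
  f z \is a fin_num /\ forall w, (f z + '[p, w - z]%:E <= f w)%E].

Definition fenchel_conj f : V -> \bar R := fun u =>
  ereal_sup [set ('[u, w]%:E - f w)%E | w in setT].

Definition support_fun S : V -> \bar R := fun u =>
  ereal_sup [set '[w, u]%:E | w in S].

Definition normal_cone S : V -> set V := fun z =>
  [set p | forall w, S w -> '[p, w - z] <= 0].

Definition argmin f S : set V :=
  [set z | S z /\ forall w, S w -> (f z <= f w)%E].

Definition weak_cvg (u : nat -> V) (l : V) : Prop :=
  forall w, '[u k, w] @[k --> \oo] --> '[l, w].

Definition op_add (S T : V -> set V) : V -> set V := fun z =>
  [set p + q | p in S z & q in T z].

Definition op_scale (a : R) (T : V -> set V) : V -> set V := fun z =>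
  [set a *: p | p in T z].

Definition zer (T : V -> set V) : set V := [set z | T z 0].

(* Throughout, B is a single-valued operator, phi the function whose
   subdifferential is added to it, and K the upper-level objective. *)
Implicit Types (B : V -> V) (phi K : V -> \bar R).

Definition vi_zeros B phi : set V :=
  zer (op_add (fun z => [set B z]) (subdiff phi)).

Definition bilevel_sol B phi K : set V := argmin K (vi_zeros B phi).

Definition gap_fun B phi (zs : V) : V -> \bar R := fun z =>
  ('[z - zs, B z]%:E + phi z - phi zs)%E.

Definition attouch_czarnecki B phi K (eps : nat -> R) : Prop :=
  forall zs, bilevel_sol B phi K zs ->
  forall ps, normal_cone (vi_zeros B phi) zs ps ->
  (\sum_(0 <= k <oo) (fenchel_conj (gap_fun B phi zs) (eps k *: ps)
                      - support_fun (vi_zeros B phi) (eps k *: ps)) < +oo)%E.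

Definition sharpness B phi K (rho : R) : Prop :=
  forall zs, bilevel_sol B phi K zs ->
  exists tau : R, 0 < tau /\
    forall z, ((tau / rho)%:E * (idist z (vi_zeros B phi) `^ rho)
               <= gap_fun B phi zs z)%E.

End convex_analysis.

Section hilbert.
Context {R : realType} {H G : hilbertType R}.

(* u = prox_phi(z), as a relation *)
Definition is_prox (phi : H -> \bar R) (z u : H) : Prop :=
  forall w, w != u -> (phi u + (2^-1 * `|u - z| ^+ 2)%:E
                       < phi w + (2^-1 * `|w - z| ^+ 2)%:E)%E.

Definition is_gradient (h : H -> R^o) (dh : H -> H) : Prop :=
  forall x, is_diff x h (fun v => '[dh x, v]).

Definition is_adjoint (A : H -> G) (As : G -> H) : Prop :=
  forall x l, '[A x, l] = '[x, As l].

Definition opnorm (A : H -> G) : R :=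
  sup [set `|A x| | x in [set x : H | `|x| <= 1]].

End hilbert.

(* An extended-real sequence that is eventually finite, with real values that
   are O(v), resp. o(v). *)
Definition ebigO {R : realType} (u : nat -> \bar R) (v : nat -> R^o) : Prop :=
  exists w : nat -> R^o, (\forall k \near \oo, u k = (w k)%:E) /\ w =O_\oo v.

Definition elittleo {R : realType} (u : nat -> \bar R) (v : nat -> R^o) : Prop :=
  exists w : nat -> R^o, (\forall k \near \oo, u k = (w k)%:E) /\ w =o_\oo v.

(* Main.v *)
Require Import Defs.
From HB Require Import structures.
From mathcomp Require Import all_boot all_order all_algebra.
From mathcomp Require Import all_classical all_reals all_analysis.
From mathcomp Require Import ring lra.

Set Implicit Arguments.
Unset Strict Implicit.
Unset Printing Implicit Defensive.

Import Order.TTheory GRing.Theory Num.Theory.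
Import numFieldNormedType.Exports.

Local Open Scope classical_set_scope.
Local Open Scope ring_scope.

(** Write [z k] for the pair [(x k, lam k)], [B] for the primal-dual operator,
    [phi] for the function [f (x) + g^* (l)] on the product, [H = h + psi] for the
    upper level objective and [T k = B + eps k * grad h] for the operator of the
    [k]-th step, which is an extragradient step for [T k + d (phi + eps k * psi)].
    Every estimate is asymptotic, so it suffices that [s] times the Lipschitz
    constant of [T k] stays below 1 from some index on.

    The proof rests on two inequalities for one step. The energy inequality
    ([step_energy]) bounds the decrease of [|z k - zs|^2], for an optimal [zs], by
    the squared lengths of the two half steps plus the gap function of the
    penalised problem. The qualification condition replaces the upper level part
    of that gap by a linear term [eps k * <ps, z - zs>] with [ps] normal to the set
    of zeros, and each of the two growth conditions says that the gap function
    minus this linear term is bounded below by minus a summable sequence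
    ([attouch_czarnecki_gap], [sharpness_gap]). Hence the distances to every
    optimal point converge and the squared half steps are summable
    ([iteration_fejer]).

    The residual inequality ([step_residual]) says that for fixed [eps] the norm of
    the residual [W], the sum of the operator and of the subgradient produced by
    the step, does not increase; it uses cyclic monotonicity of the subgradients
    at the three points of the step. Letting [eps] vary adds an error which, to
    leading order, is the decrement of [eps] times the increment of [H]
    ([step_residual_change]). As [H] is bounded along the iterates and [eps] is
    convex in [k], summation by parts turns the squared residuals into a
    nonincreasing summable sequence up to summable corrections, and therefore
    [|W k| = o (k^(-1/2))] for every decay exponent of [eps]
    ([summable_residual_rate], [iteration_rate]).

    The residual of the problem without penalty differs from [W] by [O (eps k)],
    because the subgradients of [psi] are bounded along the iterates; this gives
    the rates of [r] and [d]. The error [e] is bounded by pairings of these two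
    residuals with bounded vectors ([objective_gap]), where [g] has to coincide
    with its biconjugate ([affine_minorant], [fenchel_equality]). Convexity gives
    [eps k * (H (z k) - H (zs)) <= C * |W k|], so for exponents at most [1/2] the
    values of [H] do not exceed the optimal value in the limit, at the stated
    rate. Weak limits of the iterates are then optimal by Minty's lemma
    ([weak_limit_zero], [weak_limit_sol]) and the whole sequence converges weakly
    by Opial's lemma ([opial]). Weak compactness is obtained along ultrafilters
    from the Riesz representation. Under sharpness the linear term is dominated by
    the gap function up to [O (eps k ^ rhos)], which is [o (k^(-1/2))]; this
    bounds the values of [H] from below ([value_deficit_le]). *)

(** * Inner product spaces *)

Section inner_product.
Context {R : realType} {V : innerType R}.
Implicit Types (u v w : V) (a : R).

Lemma innerC u v : '[u, v] = '[v, u].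
Proof. by rewrite (hermC inner u v) expr0 mul1r. Qed.

Lemma innerDl u v w : '[u + v, w] = '[u, w] + '[v, w].
Proof. exact: linearDl. Qed.

Lemma innerDr u v w : '[u, v + w] = '[u, v] + '[u, w].
Proof. exact: linearDr. Qed.

Lemma innerNl u v : '[- u, v] = - '[u, v].
Proof. exact: linearNl. Qed.

Lemma innerNr u v : '[u, - v] = - '[u, v].
Proof. exact: linearNr. Qed.

Lemma innerZl a u v : '[a *: u, v] = a * '[u, v].
Proof. exact: linearZl_LR. Qed.

Lemma innerZr a u v : '[u, a *: v] = a * '[u, v].
Proof. exact: linearZr_LR. Qed.

Lemma inner0l u : '[0, u] = 0.
Proof. exact: linear0l. Qed.

Lemma inner0r u : '[u, 0] = 0.
Proof. exact: linear0r. Qed.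

Lemma inner_opprB u v w : '[u, v - w] = - '[u, w - v].
Proof. by rewrite !innerDr !innerNr opprB. Qed.

Definition innerE :=
  (innerDl, innerDr, innerNl, innerNr, innerZl, innerZr, inner0l, inner0r).

Lemma inner_ge0 u : 0 <= '[u, u].
Proof.
have [->|u0] := eqVneq u 0; first by rewrite inner0l.
exact/ltW/neq0_dnorm_gt0.
Qed.

Lemma inner_eq0 u : '[u, u] <= 0 -> u = 0.
Proof.
by have [//|u0] := eqVneq u 0; rewrite leNgt neq0_dnorm_gt0.
Qed.

Lemma inorm_ge0 u : 0 <= inorm u.
Proof. exact: sqrtr_ge0. Qed.

Lemma sqr_inorm u : inorm u ^+ 2 = '[u, u].
Proof. by rewrite sqr_sqrtr ?inner_ge0. Qed.

Lemma inormN u : inorm (- u) = inorm u.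
Proof. by rewrite /inorm !innerE opprK. Qed.

Lemma inormZ a u : inorm (a *: u) = `|a| * inorm u.
Proof. by rewrite /inorm !innerE mulrA -expr2 sqrtrM ?sqr_ge0// sqrtr_sqr. Qed.

Lemma cauchy_schwarz u v : '[u, v] <= inorm u * inorm v.
Proof.
have [->|v0] := eqVneq v 0.
  by rewrite inner0r mulr_ge0 ?inorm_ge0.
have vv : 0 < '[v, v] by exact: neq0_dnorm_gt0.
have [uv|uv] := lerP '[u, v] 0.
  by rewrite (le_trans uv) ?mulr_ge0 ?inorm_ge0.
rewrite -(@ler_pXn2r _ 2) ?nnegrE ?mulr_ge0 ?inorm_ge0 ?(ltW uv)//.
rewrite exprMn !sqr_inorm.
have := inner_ge0 ('[v, v] *: u - '[u, v] *: v).
rewrite !innerE (innerC v u).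
rewrite (_ : _ + _ = '[v, v] * ('[u, u] * '[v, v] - '[u, v] ^+ 2)); last by ring.
by rewrite pmulr_rge0// subr_ge0.
Qed.

Lemma ler_inormD u v : inorm (u + v) <= inorm u + inorm v.
Proof.
rewrite -(@ler_pXn2r _ 2)// ?nnegrE ?addr_ge0 ?inorm_ge0//.
rewrite sqrrD !sqr_inorm !innerE (innerC v u) -mulr_natr.
by have := cauchy_schwarz u v; lra.
Qed.

Lemma ler_inormB u v : inorm (u - v) <= inorm u + inorm v.
Proof. by rewrite (le_trans (ler_inormD _ _)) ?inormN. Qed.

Lemma inner_young a u v : 0 < a -> 2 * '[u, v] <= a * '[u, u] + a^-1 * '[v, v].
Proof.
move=> a0; have := inner_ge0 (a *: u - v); rewrite !innerE (innerC v u) => h.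
rewrite -(ler_pM2l a0).
rewrite [leRHS](_ : _ = a ^+ 2 * '[u, u] + '[v, v]); first by lra.
by field; rewrite gt_eqF.
Qed.

End inner_product.

(** * Minimisation of strongly convex functions and duality *)

Lemma ge0_of_small {R : realType} (a b : R) :
  (forall t, 0 < t <= 1 -> 0 <= a + t * b) -> 0 <= a.
Proof.
move=> h; rewrite leNgt; apply/negP => a0.
have b0 : 0 < b by have := h 1; rewrite ltr01 lexx mul1r => /(_ isT); lra.
have [ab|ab] := lerP (- a / 2) b; last first.
  by have := h 1; rewrite ltr01 lexx mul1r => /(_ isT); lra.
have := h (- a / 2 / b); rewrite ler_pdivrMr// mul1r ab divr_gt0//=; last by lra.
by move=> /(_ isT); rewrite mulfVK ?gt_eqF//; lra.
Qed.

Lemma ereal_cases {R : realType} (x : \bar R) : x != -oo%E ->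
  x = +oo%E \/ exists r : R, x = r%:E.
Proof. by case: x => [r| |] //= _; [right; exists r|left]. Qed.

Section subgradients.
Context {R : realType} {V : innerType R}.
Implicit Types (phi : V -> \bar R) (u w p : V).

Lemma subdiff_ge phi u p w a b : subdiff phi u p -> phi u = a%:E ->
  phi w = b%:E -> a + '[p, w - u] <= b.
Proof. by move=> [_ /(_ w)] + ua wb; rewrite ua wb -EFinD lee_fin. Qed.

Lemma subdiff_add phi psi (e : R) u p q : 0 <= e ->
  subdiff phi u p -> subdiff psi u q ->
  subdiff (fun v => phi v + e%:E * psi v)%E u (p + e *: q).
Proof.
move=> e0 [pu hp] [qu hq]; split.
  by rewrite fin_numD pu/= fin_numM.
move=> w; rewrite innerE EFinD innerZl EFinM addeACA leeD//.
have := @lee_wpmul2l _ e%:E e0 _ _ (hq w).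
by rewrite muleDr//; apply: fin_num_adde_defr.
Qed.

(** First-order optimality for the proximal subproblem: comparing the minimiser
    with the points of a segment and letting its length tend to zero. *)
Lemma prox_subdiff phi (k : R) u x : (forall w, phi w != -oo%E) ->
  econvex phi -> phi u \is a fin_num ->
  (forall w, phi u + (k / 2 * '[u - x, u - x])%:E
             <= phi w + (k / 2 * '[w - x, w - x])%:E)%E ->
  subdiff phi u (k *: (x - u)).
Proof.
move=> phiN cphi /[dup] phiu /fineK <- umin; split=> // w.
rewrite -(fineK phiu); set a := fine (phi u) in umin *.
have [->|[b bE]] := ereal_cases (phiN w); first by rewrite leey.
rewrite bE -EFinD lee_fin -subr_ge0.
apply: (@ge0_of_small _ _ (k / 2 * '[w - u, w - u])) => t /andP[t0 t1].
have := cphi w u t; rewrite (ltW t0) t1 => /(_ isT).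
rewrite bE -(fineK phiu) -/a -!EFinM -EFinD => le_t.
have := le_trans (umin (t *: w + (1 - t) *: u)) (leeD2r _ le_t).
rewrite -!EFinD lee_fin.
rewrite (_ : t *: w + _ - x = (u - x) + t *: (w - u)); last first.
  by rewrite scalerBl scale1r scalerBr addrCA addrAC.
rewrite -(opprB u x) -(pmulr_rge0 _ t0).
move: (u - x) (w - u) (innerC (u - x) (w - u)) => y z yz.
by rewrite !innerE -yz; lra.
Qed.

End subgradients.

Section hilbert.
Context {R : realType} {H : hilbertType R}.
Implicit Types (f : H -> \bar R) (x u v w p : H).

Lemma inorm_norm x : inorm x = `|x|.
Proof. by rewrite /inorm inner_norm sqrtr_sqr normr_id. Qed.

Lemma inner_le_norm u v : '[u, v] <= `|u| * `|v|.
Proof. by rewrite -!inorm_norm cauchy_schwarz. Qed.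

(** A minimising sequence is Cauchy by strong convexity at midpoints, and lower
    semicontinuity passes to its limit. *)
Lemma prox_exists f x (k al be : R) : 0 < k -> eproper f -> econvex f ->
  lower_semicontinuous f ->
  (forall u, (al - be * `|u - x|)%:E <= f u)%E ->
  exists u, f u \is a fin_num /\
    forall w, (f u + (k / 2 * '[u - x, u - x])%:E
               <= f w + (k / 2 * '[w - x, w - x])%:E)%E.
Proof.
move=> k0 [fN [u0 fu0]] cf lf flb.
pose N u : R := k / 2 * '[u - x, u - x].
pose S : set R := [set t | exists u r, f u = r%:E /\ t = r + N u].
have S0 : S !=set0.
  by exists (fine (f u0) + N u0), u0, (fine (f u0)); rewrite fineK.
have Slb : lbound S (al - be ^+ 2 / (2 * k)).
  move=> _ [u [r [fur ->]]]; have := flb u; rewrite fur lee_fin /N inner_norm.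
  move: `|u - x| => y; have := sqr_ge0 (k * y - be) => h1 h2.
  rewrite -subr_ge0 -(pmulr_rge0 _ (mulr_gt0 (ltr0n R 2) k0)).
  rewrite [X in 0 <= X](_ : _ = 2 * k * (r - al + be * y) + (k * y - be) ^+ 2);
    last by field; rewrite gt_eqF.
  by rewrite addr_ge0// mulr_ge0//; [rewrite mulr_ge0// ltW|lra].
have Sinf : has_inf S by split=> //; exists (al - be ^+ 2 / (2 * k)).
pose m := inf S.
have mle u r : f u = r%:E -> m <= r + N u.
  by move=> fur; apply: ge_inf; [exact: Sinf.2|exists u, r].
have /choice[U /choice[V UV]] : forall n : nat, exists u r,
    f u = r%:E /\ r + N u < m + n.+1%:R^-1.
  move=> n.
  have n0 : 0 < n.+1%:R^-1 :> R by rewrite invr_gt0.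
  have [_ [u [r [fur ->]]] lt] := inf_adherent n0 Sinf.
  by exists u, r.
have N_mid u v : N (2^-1 *: u + (1 - 2^-1) *: v) =
    2^-1 * N u + 2^-1 * N v - k / 8 * `|u - v| ^+ 2.
  rewrite /N -inner_norm.
  rewrite (_ : _ *: u + _ - x = 2^-1 *: (u - x) + 2^-1 *: (v - x)); last first.
    rewrite [1 - 2^-1 : R](_ : _ = 2^-1); last by field.
    rewrite !scalerBr addrACA -opprD -scalerDl.
    by rewrite [2^-1 + 2^-1 : R](_ : _ = 1) ?scale1r//; field.
  have -> : u - v = (u - x) - (v - x) by rewrite opprB addrA subrK.
  move: (u - x) (v - x) => y z.
  by rewrite !innerE (innerC z y); field.
have mid_le (n p : nat) : k / 8 * `|U n - U p| ^+ 2
    <= 2^-1 * (n.+1%:R^-1 + p.+1%:R^-1).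
  have [fUn Un] := UV n; have [fUp Up] := UV p.
  have := cf (U n) (U p) 2^-1; rewrite invr_ge0 invf_le1//= ler1n ler0n => /(_ isT).
  rewrite fUn fUp -!EFinM -EFinD.
  have := N_mid (U n) (U p).
  move: (_ *: U n + _) => w Nw.
  have [->|[r fw]] := ereal_cases (fN w); first by rewrite leye_eq.
  rewrite fw lee_fin; have := mle _ _ fw; rewrite Nw.
  move: Un Up; set a1 := _.+1%:R^-1; set a2 := _.+1%:R^-1.
  lra.
have Ucvg : cvg (U n @[n --> \oo]).
  apply: cauchy_cvg; apply: cauchy_exP => e e0.
  pose n := Num.bound (8 / (k * e ^+ 2)).
  exists (U n).
  have : \forall p \near \oo, ball (U n) e (U p); last by [].
  near=> p; rewrite -ball_normE /ball_/=.
  rewrite -(@ltr_pXn2r _ 2) ?nnegrE ?(ltW e0)//.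
  rewrite -(@ltr_pM2l _ (k / 8)) ?divr_gt0//.
  apply: (le_lt_trans (mid_le _ _)).
  have np : (n <= p)%N by near: p; exists n.
  have : p.+1%:R^-1 <= n.+1%:R^-1 :> R by rewrite lef_pV2 ?posrE// ler_nat.
  have : n.+1%:R^-1 < k / 8 * e ^+ 2.
    rewrite -[ltRHS]invrK ltf_pV2 ?posrE//; last first.
      by rewrite invr_gt0 mulr_gt0 ?divr_gt0 ?exprn_gt0.
    have -> : (k / 8 * e ^+ 2)^-1 = 8 / (k * e ^+ 2).
      by field; rewrite !gt_eqF.
    have := archi_boundP (ltW (divr_gt0 (ltr0n R 8) (mulr_gt0 k0 (exprn_gt0 2 e0)))).
    by move/lt_trans; apply; rewrite ltr_nat.
  by move: n.+1%:R^-1 p.+1%:R^-1 => a b; lra.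
pose u := lim (U n @[n --> \oo]).
have NU : N (U n) @[n --> \oo] --> N u.
  rewrite /N; apply: cvgMr; under eq_fun do rewrite inner_norm.
  rewrite inner_norm; apply: cvgM; apply: cvg_norm; apply: cvgB => //; exact: cvg_cst.
have le_m t : (t%:E < f u)%E -> t + N u <= m.
  move=> /lf[A Au At].
  apply: (@ler_cvg_to _ \oo _ _ (fun n => t + N (U n)) (fun n => m + n.+1%:R^-1)).
  - by apply: cvgD => //; exact: cvg_cst.
  - rewrite -[X in _ --> X]addr0; apply: cvgD; first exact: cvg_cst.
    exact: cvg_harmonic.
  - near=> n; have [fUn Un] := UV n.
    have /At : A (U n) by near: n; exact: Ucvg.
    by rewrite fUn lte_fin; move: Un; move: n.+1%:R^-1 => b /=; lra.
have fu : f u \is a fin_num.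
  have [fu|[r ->]//] := ereal_cases (fN u).
  by have := le_m (m - N u + 1); rewrite fu ltry => /(_ isT); lra.
exists u; split=> // w.
rewrite -(fineK fu); have [->|[r fw]] := ereal_cases (fN w); first by rewrite leey.
rewrite fw -!EFinD lee_fin -/(N u) -/(N w); apply: le_trans (mle _ _ fw).
apply/ler_addgt0Pr => e e0.
have := le_m (fine (f u) - e); rewrite -(fineK fu) lte_fin /=; lra.
Unshelve. all: by end_near. Qed.

End hilbert.

Section hilbert_duality.
Context {R : realType} {H : hilbertType R}.
Implicit Types (f : H -> \bar R) (x u v w p : H).

(** Lower semicontinuity at a single point bounds a convex function from below
    near that point, and convexity propagates the bound along rays at a linear
    rate. *)
Lemma lsc_lower_bound f : eproper f -> econvex f -> lower_semicontinuous f ->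
  exists al be : R, 0 <= be /\ forall u, ((al - be * `|u|)%:E <= f u)%E.
Proof.
move=> [fN [x0 fx0]] cf lf; set r0 := fine (f x0).
have fx0E : f x0 = r0%:E by rewrite /r0 fineK.
(* The radius is halved so that points at distance [rho] lie in the open ball. *)
have [A /nbhs_ballP[e /= e0 eA] Af] : exists2 A, nbhs x0 A &
    forall y, A y -> ((r0 - 1)%:E < f y)%E.
  by apply: lf; rewrite fx0E lte_fin; lra.
pose rho := e / 2; have rho0 : 0 < rho by rewrite divr_gt0.
have key u b : f u = b%:E -> r0 - 1 - `|u - x0| / rho <= b.
  move=> fu; have [dr|dr] := ltP `|u - x0| e.
    have /Af : A u by apply: eA; rewrite -ball_normE /= distrC.
    rewrite fu lte_fin => h.
    by have := divr_ge0 (normr_ge0 (u - x0)) (ltW rho0); lra.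
  have d0 : 0 < `|u - x0| by lra.
  pose t := rho / `|u - x0|.
  have t01 : 0 <= t <= 1.
    by rewrite (divr_ge0 (ltW rho0) (ltW d0))/= ler_pdivrMr// mul1r /rho; lra.
  have /Af : A (t *: u + (1 - t) *: x0).
    apply: eA; rewrite -ball_normE /ball_/= distrC.
    have -> : t *: u + (1 - t) *: x0 - x0 = t *: (u - x0).
      by rewrite scalerBl scale1r scalerBr addrCA addrAC subrr add0r.
    rewrite normrZ ger0_norm; last by case/andP: t01.
    by rewrite /t mulfVK ?gt_eqF// /rho; lra.
  move=> /lt_le_trans /(_ (cf _ _ _ t01)).
  rewrite fu fx0E -!EFinM -EFinD lte_fin => h.
  have : r0 - `|u - x0| / rho <= b; last by lra.
  rewrite lerBlDr -lerBlDl ler_pdivlMr//.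
  have : t * `|u - x0| = rho by rewrite mulfVK ?gt_eqF.
  have t0 : 0 < t by rewrite divr_gt0.
  move: `|u - x0| d0 => dd dd0 <-.
  have : t * (r0 - b) <= 1 by lra.
  by move=> /(ler_wpM2r (ltW dd0)); lra.
exists (r0 - 1 - `|x0| / rho), rho^-1; split; first by rewrite invr_ge0 ltW.
move=> u; have [->|[b fu]] := ereal_cases (fN u); first by rewrite leey.
rewrite fu lee_fin; apply: le_trans (key _ _ fu).
have : `|u - x0| / rho <= `|u| / rho + `|x0| / rho.
  by rewrite -mulrDl ler_wpM2r ?ler_normB// invr_ge0 ltW.
by rewrite (mulrC rho^-1); lra.
Qed.

(** The Fenchel-Moreau theorem, as the statement that the affine minorants of a
    closed convex function recover it pointwise. The minorant is the subgradient
    at the proximal point of [x] for a large parameter [k]: if the proximal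
    point is close to [x], lower semicontinuity makes its value at [x] exceed
    [c]; otherwise the quadratic term does. *)
Lemma affine_minorant f x (c : R) : eproper f -> econvex f ->
  lower_semicontinuous f -> (c%:E < f x)%E ->
  exists p b, (forall y, ('[p, y] + b)%:E <= f y)%E /\ c < '[p, x] + b.
Proof.
move=> pf cf lf cx; have [al [be [be0 flb]]] := lsc_lower_bound pf cf lf.
have [A /nbhs_ballP[r /= r0 rA] Af] := lf _ _ cx.
pose al' := al - be * `|x|.
have flb' u : ((al' - be * `|u - x|)%:E <= f u)%E.
  apply: le_trans (flb u); rewrite lee_fin /al'.
  have : be * `|u| <= be * `|u - x| + be * `|x|; last by lra.
  by rewrite -mulrDr ler_wpM2l// -{1}(subrK x u) ler_normD.
(* At distance [y >= r] this makes [k * y ^+ 2] at least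
   [`|c - al'| + 1 + be * y]. *)
pose k := (`|c - al'| + 1) / r ^+ 2 + be / r.
have k0 : 0 < k.
  by rewrite ltr_wpDr ?divr_ge0 ?(ltW r0)// divr_gt0 ?exprn_gt0// ltr_wpDl.
have [u [fu umin]] := prox_exists k0 pf cf lf flb'.
have [_ sub] := prox_subdiff pf.1 cf fu umin.
have fuE := esym (fineK fu); set b := fine (f u) in fuE.
exists (k *: (x - u)), (b - '[k *: (x - u), u]); split.
  move=> y; apply: le_trans (sub y); rewrite fuE -EFinD lee_fin innerDr innerNr.
  by lra.
rewrite addrCA -innerNr -innerDr innerZl inner_norm distrC.
have [ur|ur] := ltP `|u - x| r.
  have /Af : A u by apply: rA; rewrite -ball_normE /= distrC.
  rewrite fuE lte_fin => /lt_le_trans; apply.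
  by rewrite lerDl mulr_ge0// ?sqr_ge0 ?ltW.
have := flb' u; rewrite fuE lee_fin.
move: `|u - x| ur => y ry.
have y1 : 1 <= y / r by rewrite ler_pdivlMr// mul1r.
have -> : k * y ^+ 2 = (`|c - al'| + 1) * (y / r) ^+ 2 + be * y * (y / r).
  by rewrite /k; field; rewrite gt_eqF.
have : `|c - al'| + 1 <= (`|c - al'| + 1) * (y / r) ^+ 2.
  by rewrite ler_peMr ?addr_ge0// exprn_ege1.
have : be * y <= be * y * (y / r).
  by rewrite ler_peMr// mulr_ge0//; lra.
by have := ler_norm (c - al'); lra.
Qed.

(** Riesz: the representing vector minimises [|u|^2 / 2 - l u]. *)
Lemma riesz (l : H -> R) (C : R) : linear_for *%R l ->
  (forall u, `|l u| <= C * `|u|) -> exists p, forall u, l u = '[p, u].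
Proof.
move=> ll lC.
have lD u v : l (u + v) = l u + l v by have := ll 1 u v; rewrite scale1r mul1r.
have l0 : l 0 = 0 by have := lD 0 0; rewrite addr0; lra.
have lZ a u : l (a *: u) = a * l u by have := ll a u 0; rewrite !addr0 l0 addr0.
have lN u : l (- u) = - l u by rewrite -scaleN1r lZ mulN1r.
pose f u : \bar R := (- l u)%:E.
have pf : eproper f by split=> //; exists 0.
have cf : econvex f.
  move=> x y t _; rewrite /f lD !lZ -!EFinM -EFinD lee_fin.
  by lra.
have lf : lower_semicontinuous f.
  move=> x a; rewrite lte_fin => ax.
  have [C0'|C0'] := leP C 0.
    exists setT; first exact: filterT.
    move=> y _; rewrite lte_fin.
    have lz z : l z = 0.
      apply/eqP; rewrite -normr_le0; apply: le_trans (lC z) _.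
      by rewrite mulr_le0_ge0.
    by rewrite lz; move: ax; rewrite lz.
  exists (ball x ((- l x - a) / C)).
    by apply: nbhsx_ballx; rewrite divr_gt0//; lra.
  move=> y; rewrite -ball_normE /ball_/= ltr_pdivlMr// mulrC lte_fin.
  by have := lC (y - x); rewrite lD lN (distrC y) => /(le_trans (ler_norm _)); lra.
have flb u : ((0 - C * `|u - 0|)%:E <= f u)%E.
  rewrite /f lee_fin subr0 sub0r lerN2; exact: le_trans (ler_norm _) (lC u).
have [p [fp pmin]] := prox_exists ltr01 pf cf lf flb.
have [_ sub] := prox_subdiff pf.1 cf fp pmin.
have le_l v : l v <= '[p, v].
  have := sub (p + v); rewrite /f -EFinD lee_fin lD (addrAC p) subrr !add0r scale1r.
  by rewrite innerNl; lra.
exists p => u; apply/eqP; rewrite eq_le le_l/=.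
by have := le_l (- u); rewrite lN innerNr lerN2.
Qed.

End hilbert_duality.

(** * Conjugates, variational inequalities and gradients *)

Section conjugate.
Context {R : realType} {V : innerType R}.
Implicit Types (g : V -> \bar R) (x y l : V).

Lemma fenchel_young g l x : ('[l, x]%:E - g x <= fenchel_conj g l)%E.
Proof. by apply: ereal_sup_ubound; exists x. Qed.

Lemma fenchel_conj_gtNy g l : eproper g -> fenchel_conj g l != -oo%E.
Proof.
move=> [_ [x /fineK gx]]; have := fenchel_young g l x.
by rewrite -gx -EFinB; case: fenchel_conj.
Qed.

Lemma fenchel_conj_convex g : eproper g -> econvex (fenchel_conj g).
Proof.
move=> pg x y t /andP[t0 t1]; apply: ge_ereal_sup => _ [w _ <-].
have [->|[r gw]] := ereal_cases (pg.1 w); first by rewrite addeNy leNye.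
have hx := fenchel_young g x w; have hy := fenchel_young g y w.
rewrite gw -EFinB in hx hy *.
have := leeD (lee_wpmul2l (_ : 0 <= t%:E)%E hx)
  (lee_wpmul2l (_ : 0 <= (1 - t)%:E)%E hy).
rewrite !lee_fin subr_ge0 => /(_ t0 t1); apply: le_trans.
by rewrite -!EFinM -EFinD lee_fin !innerE; lra.
Qed.

Lemma fenchel_conj_minorant g l (c : R) : eproper g ->
  (c%:E < fenchel_conj g l)%E ->
  exists p b, (forall y, ('[p, y] + b)%:E <= fenchel_conj g y)%E /\ c < '[p, l] + b.
Proof.
move=> pg /ereal_sup_gt[_ [w _ <-]].
have [->|[r gw]] := ereal_cases (pg.1 w); first by rewrite addeNy.
rewrite gw -EFinB lte_fin => cw; exists w, (- r); split; last by rewrite innerC.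
by move=> y; have := fenchel_young g y w; rewrite gw -EFinB innerC.
Qed.

End conjugate.

Section conjugate_hilbert.
Context {R : realType} {G : hilbertType R}.

(** Equality in Fenchel's inequality at [xi] in the subdifferential of the
    conjugate; this is where [g] has to coincide with its biconjugate. *)
Lemma fenchel_equality (g : G -> \bar R) (l xi : G) : eproper g -> econvex g ->
  lower_semicontinuous g -> subdiff (fenchel_conj g) l xi ->
  g xi = ('[xi, l] - fine (fenchel_conj g l))%:E.
Proof.
move=> pg cg lg [/fineK gl sub]; set r := fine _ in gl *.
apply/eqP; rewrite eq_le; apply/andP; split; last first.
  have := fenchel_young g l xi; rewrite -gl.
  have [->|[b ->]] := ereal_cases (pg.1 xi); first by rewrite leey.
  by rewrite -EFinB !lee_fin innerC; lra.
rewrite leNgt; apply/negP => lt.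
have [p [b [minp]]] := affine_minorant pg cg lg lt.
have gsp : (fenchel_conj g p <= (- b)%:E)%E.
  apply: ge_ereal_sup => _ [w _ <-].
  have := minp w; have [->|[c ->]] := ereal_cases (pg.1 w).
    by rewrite addeNy leNye.
  by rewrite -EFinB !lee_fin; lra.
have := le_trans (sub p) gsp; rewrite -gl -EFinD lee_fin innerDr innerNr.
by rewrite (innerC p xi); lra.
Qed.

End conjugate_hilbert.

Section variational_inequality.
Context {R : realType} {V : innerType R}.
Implicit Types (phi : V -> \bar R) (B : V -> V) (z w : V).

(** Minty's lemma: a solution of the weak form of the variational inequality
    solves the strong one, by testing with points of a segment ending at [z]. *)
Lemma minty phi B (L : R) z : (forall w, phi w != -oo%E) -> econvex phi ->
  (forall u v, inorm (B u - B v) <= L * inorm (u - v)) ->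
  phi z \is a fin_num ->
  (forall w, phi z <= phi w + '[B w, w - z]%:E)%E -> subdiff phi z (- B z).
Proof.
move=> phiN cphi BL /[dup] phiz /fineK <-; set a := fine _ => weak; split=> // w.
rewrite -(fineK phiz) -/a.
have [->|[b bE]] := ereal_cases (phiN w); first by rewrite leey.
rewrite bE -EFinD lee_fin -subr_ge0.
apply: (@ge0_of_small _ _ (L * inorm (w - z) ^+ 2)) => t /andP[t0 t1].
have := cphi w z t; rewrite (ltW t0) t1 => /(_ isT).
rewrite bE -(fineK phiz) -/a -!EFinM -EFinD => le_t.
have := le_trans (weak (t *: w + (1 - t) *: z)) (leeD2r _ le_t).
rewrite -EFinD lee_fin.
have wt : t *: w + (1 - t) *: z - z = t *: (w - z).
  by rewrite scalerBl scale1r scalerBr addrCA addrAC subrr add0r.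
rewrite wt; set u := _ + _ *: z in wt *.
have := BL u z; rewrite wt inormZ (gtr0_norm t0) => BLu.
have : '[B u - B z, w - z] <= t * (L * inorm (w - z) ^+ 2).
  apply: (le_trans (cauchy_schwarz _ _)).
  by apply: le_trans (ler_wpM2r (inorm_ge0 _) BLu) _; rewrite expr2; lra.
rewrite -(pmulr_rge0 _ t0); move: (w - z) => v; rewrite !innerE => h1 h2.
by have := ler_wpM2l (ltW t0) h1; lra.
Qed.

Lemma vi_zerosP B phi z : vi_zeros B phi z <-> subdiff phi z (- B z).
Proof.
split=> [[_ -> [q qz]]|h]; first by move=> /eqP; rewrite addrC addr_eq0 => /eqP <-.
by exists (B z) => //; exists (- B z) => //; rewrite subrr.
Qed.

End variational_inequality.

Section gradient.
Context {R : realType} {H : hilbertType R}.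

(** The gradient inequality of convex functions, obtained by letting the
    parameter of the convexity inequality tend to zero. *)
Lemma gradient_ineq (h : H -> R) (dh : H -> H) (x y : H) :
  convex_function [set: convex_lmodType H] h -> is_gradient h dh ->
  h x + '[dh x, y - x] <= h y.
Proof.
move=> ch gh; pose h' : H -> R^o := h.
have [dx dE] := gh x.
have der : derivable h' x (y - x) by exact: diff_derivable.
have : 'D_(y - x) h' x = '[dh x, y - x] by rewrite deriveE// /h' dE.
rewrite -lerBrDl => <-.
apply: (@ler_cvg_to _ (0^'+ : set_system R) _ _
  (fun t : R => t^-1 *: ((h' \o shift x) (t *: (y - x)) - h' x) : R)
  (fun=> h y - h x)).
- exact: cvg_dnbhs_at_right der.
- exact: cvg_cst.
- near=> t.
  have t0 : 0 < t by near: t; exact: nbhs_right_gt.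
  have t1 : t <= 1 by near: t; apply: nbhs_right_le.
  have le_t : h (t *: y + (1 - t) *: x) <= t * h y + (1 - t) * h x.
    by apply: (ch (Itv01 (ltW t0) t1) y x); rewrite in_setE.
  rewrite -[leLHS]/(t^-1 * (h (t *: (y - x) + x) - h x)).
  rewrite mulrC ler_pdivrMr// scalerBr -addrA (addrC _ x).
  by move: le_t; rewrite scalerBl scale1r; lra.
Unshelve. all: by end_near. Qed.

End gradient.

(** A function that is the pointwise supremum of its affine minorants is weakly
    lower semicontinuous; this is the form in which closedness is used. *)
Definition sup_affine {R : realType} {V : innerType R} (phi : V -> \bar R) :=
  forall u (c : R), (c%:E < phi u)%E ->
  exists p b, (forall v, ('[p, v] + b)%:E <= phi v)%E /\ c < '[p, u] + b.

(** * Weak convergence *)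

(** Every bounded linear functional is an inner product. The predicate isolates
    the only consequence of completeness that weak compactness needs; unlike
    completeness of the norm it passes to products without comparing norms. *)
Definition riesz_space {R : realType} (V : innerType R) :=
  forall (l : V -> R) (C : R), linear_for *%R l ->
  (forall u, `|l u| <= C * inorm u) -> exists p, forall u, l u = '[p, u].

Lemma riesz_space_hilbert {R : realType} (H : hilbertType R) : riesz_space H.
Proof.
move=> l C ll lC; apply: (riesz (C := C) ll) => u.
by rewrite -inorm_norm.
Qed.

Lemma riesz_space_prod {R : realType} (V W : innerType R) :
  riesz_space V -> riesz_space W -> riesz_space (V * W)%type.
Proof.
move=> rV rW l C ll lC.
have lD u v : l (u + v) = l u + l v by have := ll 1 u v; rewrite scale1r mul1r.
have [p pE] : exists p, forall u, l (u, 0) = '[p, u].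
  apply: (rV _ C) => [a u v|u].
    rewrite -ll; congr l; apply/pair_equal_spec; split => //=.
    by rewrite scaler0 addr0.
  by apply: le_trans (lC _) _; rewrite /inorm prod_innerE/= inner0l addr0.
have [q qE] : exists q, forall u, l (0, u) = '[q, u].
  apply: (rW _ C) => [a u v|u].
    rewrite -ll; congr l; apply/pair_equal_spec; split => //=.
    by rewrite scaler0 addr0.
  by apply: le_trans (lC _) _; rewrite /inorm prod_innerE/= inner0l add0r.
exists (p, q) => -[u v]; rewrite prod_innerE/= -pE -qE -lD; congr l.
by apply/pair_equal_spec; rewrite /= addr0 add0r.
Qed.

Lemma ultra_cvg_bounded {R : realType} (U : set_system nat) (a : nat -> R)
    (M : R) : UltraFilter U -> (\forall k \near U, `|a k| <= M) ->
  exists c : R, a k @[k --> U] --> c.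
Proof.
move=> UU aM; have PU := @ultra_proper _ _ UU.
have := @segment_compact R (- M) M => /(_ (a k @[k --> U]) _)[].
  by apply: filterS aM => k; rewrite /= in_itv/= -ler_norml.
move=> c [_ cc]; exists c => A Ac.
have [//|UA] := in_ultra_setVsetC (a @^-1` A) UU.
by have [x []] := cc (~` A) A UA Ac.
Qed.

Section weak.
Context {R : realType} {V : innerType R}.
Implicit Types (z : nat -> V) (U : set_system nat).

(** Bounded sequences converge weakly along ultrafilters: the pointwise limits
    of the functionals [w |-> '[z k, w]] form a bounded functional. *)
Lemma ultra_weak_cvg z U (M : R) : riesz_space V -> UltraFilter U ->
  (\forall k \near U, inorm (z k) <= M) ->
  exists p, forall w, '[z k, w] @[k --> U] --> '[p, w].
Proof.
move=> rV UU zM; have PU := @ultra_proper _ _ UU.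
have bnd w : \forall k \near U, `|'[z k, w]| <= M * inorm w.
  apply: filterS zM => k zk; apply: (@le_trans _ _ (inorm (z k) * inorm w)).
    rewrite ler_norml cauchy_schwarz andbT.
    by rewrite lerNl -innerNl -(inormN (z k)) cauchy_schwarz.
  by rewrite ler_wpM2r ?inorm_ge0.
have /choice[l lE] : forall w, exists c : R, '[z k, w] @[k --> U] --> c.
  by move=> w; exact: ultra_cvg_bounded UU (bnd w).
have [p pE] : exists p, forall u, l u = '[p, u].
  apply: (rV l M) => [a u v|u].
    apply: (cvg_unique _ (lE (a *: u + v))) => //.
    have -> : (fun k => '[z k, a *: u + v]) = (fun k => a * '[z k, u] + '[z k, v]).
      by apply/funext => k; rewrite innerDr innerZr.
    by apply: cvgD => //; apply: cvgMr.
  apply: (@ler_cvg_to _ (U : set_system nat) _ _ (fun k => `|'[z k, u]|)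
    (fun=> M * inorm u)) => //; first exact: cvg_norm.
  exact: cvg_cst.
by exists p => w; rewrite -pE.
Qed.

(** Opial's lemma. Two weak limits along ultrafilters coincide because the
    difference of the two squared distances, which converges, is affine in
    the iterate. *)
Lemma opial z (S : set V) (M : R) : riesz_space V ->
  (\forall k \near \oo, inorm (z k) <= M) ->
  (forall p, S p -> cvg ('[z k - p, z k - p] @[k --> \oo])) ->
  (forall U p, UltraFilter U -> \oo `<=` U ->
    (forall w, '[z k, w] @[k --> U] --> '[p, w]) -> S p) ->
  exists2 p, S p & weak_cvg z p.
Proof.
move=> rV zM Scvg Scl.
have lim_ex U : UltraFilter U -> \oo `<=` U ->
    exists2 p, S p & forall w, '[z k, w] @[k --> U] --> '[p, w].
  move=> UU oU; have [p zp] := ultra_weak_cvg rV UU (oU _ zM).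
  by exists p => //; exact: Scl zp.
have [U0 [UU0 oU0]] := ultraFilterLemma (eventually_filter).
have [p Sp zp] := lim_ex _ UU0 oU0.
exists p => // w A Aw; apply: contrapT => nA.
pose F := within (~` ((fun k => '[z k, w]) @^-1` A)) \oo.
have PF : ProperFilter F.
  apply: Build_ProperFilter_ex => B FB; apply: contrapT => nB; apply: nA.
  have : \oo ((fun k => '[z k, w]) @^-1` A); last by [].
  rewrite /F /within /= in FB.
  apply: filterS FB => k /= kB; apply: contrapT => kA.
  by apply: nB; exists k; exact: kB.
have [U1 [UU1 FU1]] := ultraFilterLemma PF.
have oU1 : \oo `<=` U1.
  by move=> B oB; apply: FU1; apply: filterS oB => k.
have [q Sq zq] := lim_ex _ UU1 oU1.
have PU0 := @ultra_proper _ _ UU0; have PU1 := @ultra_proper _ _ UU1.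
have [c zc] : exists c : R, '[z k, p - q] @[k --> \oo] --> c.
  exists (2^-1 * (lim ('[z k - q, z k - q] @[k --> \oo])
     - lim ('[z k - p, z k - p] @[k --> \oo]) + ('[p, p] - '[q, q]))).
  have -> : (fun k => '[z k, p - q]) = (fun k => 2^-1 *
      ('[z k - q, z k - q] - '[z k - p, z k - p] + ('[p, p] - '[q, q]))).
    by apply/funext => k; rewrite !innerE (innerC p) (innerC q); lra.
  by apply: cvgMr; apply: cvgD (cvg_cst _); apply: cvgB; exact: Scvg.
have pqE (r : V) U : ProperFilter U -> \oo `<=` U ->
    (forall w, '[z k, w] @[k --> U] --> '[r, w]) -> '[r, p - q] = c.
  move=> PU oU zr; apply: (cvg_unique _ (zr (p - q))) => //.
  by apply: cvg_trans zc => B; exact: oU.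
have pq : p = q.
  apply/eqP; rewrite -subr_eq0; apply/eqP/inner_eq0.
  by rewrite innerDl innerNl (pqE p U0)// (pqE q U1)// subrr.
have UA : U1 ((fun k => '[z k, w]) @^-1` A) by apply: zq; rewrite -pq.
have UnA : U1 (~` ((fun k => '[z k, w]) @^-1` A)).
  by apply: FU1; rewrite /F /within /=; apply: filterE.
have : U1 set0 by rewrite -(setICr ((fun k => '[z k, w]) @^-1` A)); exact: filterI.
exact: filter_not_empty.
Qed.

End weak.

(** * Real sequences *)

Section real_sequences.
Context {R : realType}.
Implicit Types (a b u q w h eps : nat -> R) (K n : nat).

(** For nonnegative terms this is summability of the tail from [K] on. *)
Definition bounded_sums K u := exists M, forall n, \sum_(K <= k < n) u k <= M.

Lemma bounded_sums_le K u v C : 0 <= C -> (forall k, (K <= k)%N -> u k <= C * v k) ->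
  bounded_sums K v -> bounded_sums K u.
Proof.
move=> C0 uv [M vM]; exists (C * M) => n.
apply: (@le_trans _ _ (C * \sum_(K <= k < n) v k)); last exact: ler_wpM2l.
by rewrite mulr_sumr !big_nat; apply: ler_sum => k /andP[/uv].
Qed.

Lemma bounded_sumsD K u v : bounded_sums K u -> bounded_sums K v ->
  bounded_sums K (fun k => u k + v k).
Proof.
move=> [M uM] [N vN]; exists (M + N) => n.
by rewrite big_split/= lerD.
Qed.

Lemma bounded_sums_telescope K eps : (forall k, 0 <= eps k) ->
  bounded_sums K (fun k => eps k - eps k.+1).
Proof.
move=> eps0; exists (eps K) => n; have [Kn|nK] := leqP K n; last first.
  by rewrite big_geq// ltnW.
rewrite (eq_bigr (fun k => (- eps k.+1) - (- eps k))) => [|k _].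
  by rewrite (telescope_sumr (fun k => - eps k))//; have := eps0 n; lra.
by rewrite opprK addrC.
Qed.

Lemma bounded_sums_cvg K u : (forall k, (K <= k)%N -> 0 <= u k) ->
  bounded_sums K u -> cvg (\sum_(K <= k < n) u k @[n --> \oo]).
Proof.
move=> u0 [M uM]; apply: nondecreasing_is_cvgn.
  apply/nondecreasing_seqP => n; have [Kn|nK] := leqP K n; last first.
    by rewrite !big_geq// ltnW.
  by rewrite big_nat_recr//= lerDl u0.
by exists M => _ [n _ <-].
Qed.

(** Subtracting the partial sums of [b] makes [a] nonincreasing, and the total
    decrease pays for the sums of [u]. *)
Lemma quasi_fejer K a b u :
  (forall k, (K <= k)%N -> [/\ 0 <= a k, 0 <= b k & 0 <= u k]) ->
  (forall k, (K <= k)%N -> a k.+1 + u k <= a k + b k) ->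
  bounded_sums K b -> cvg (a k @[k --> \oo]) /\ bounded_sums K u.
Proof.
move=> ge0 step sb.
have key n : (K <= n)%N ->
    a n + \sum_(K <= k < n) u k <= a K + \sum_(K <= k < n) b k.
  elim: n => [|n IH]; first by rewrite leqn0 => /eqP ->; rewrite !big_geq.
  rewrite leq_eqVlt => /predU1P[<-|]; first by rewrite !big_geq.
  rewrite ltnS => Kn; rewrite !big_nat_recr//=.
  by have := IH Kn; have := step _ Kn; lra.
have [M bM] := sb; split; last first.
  exists (a K + M) => n; have [Kn|nK] := leqP K n; last first.
    rewrite big_geq 1?ltnW//; have [aK _ _] := ge0 K (leqnn _).
    by have := bM K; rewrite big_geq//; lra.
  by have [an _ _] := ge0 n Kn; have := key n Kn; have := bM n; lra.
have bcvg := bounded_sums_cvg (fun k Kk => let: And3 _ b0 _ := ge0 k Kk in b0) sb.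
have : cvg (a k - \sum_(K <= i < k) b i @[k --> \oo]).
  apply: (@near_nonincreasing_is_cvgn _ _ (- M)).
    exists K => // n /= Kn m /= nm.
    elim: m nm => [|m IH]; first by rewrite leqn0 => /eqP ->.
    rewrite leq_eqVlt => /predU1P[<-//|]; rewrite ltnS => nm.
    apply: le_trans (IH nm); have Km := leq_trans Kn nm.
    rewrite big_nat_recr//=; have [_ _ um] := ge0 m Km.
    by have := step m Km; lra.
  exists K => // n /= Kn; have [an _ _] := ge0 n Kn.
  by have := bM n; lra.
move=> abcvg.
have -> : a = (fun k => a k - \sum_(K <= i < k) b i)
    \+ (fun k => \sum_(K <= i < k) b i).
  by apply/funext => k /=; rewrite subrK.
exact: is_cvgD.
Qed.

(** The terms with indices in [[N, n[] are all at least the last one, so [n]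
    times the last one is controlled by a tail of the series. *)
Lemma nonincreasing_summable K q :
  (forall k, (K <= k)%N -> 0 <= q k) ->
  (forall k, (K <= k)%N -> q k.+1 <= q k) ->
  bounded_sums K q -> k%:R * q k @[k --> \oo] --> (0 : R).
Proof.
move=> q0 dq sq; have := bounded_sums_cvg q0 sq.
set S := fun n => _ => Scvg.
have mono m n : (K <= m)%N -> (m <= n)%N -> q n <= q m.
  move=> Km; elim: n => [|n IH]; first by rewrite leqn0 => /eqP ->.
  rewrite leq_eqVlt => /predU1P[<-//|]; rewrite ltnS => mn.
  by apply: le_trans (IH mn); rewrite dq// (leq_trans Km).
apply/cvgrPdist_le => e e0.
have [N _ SN] : \forall n \near \oo, `|lim (S n @[n --> \oo]) - S n| <= e / 4.
  by move/cvgrPdist_le : Scvg; apply; rewrite divr_gt0.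
pose N' := maxn N K.
near=> n; rewrite sub0r normrN.
have nN : (2 * N' <= n)%N by near: n; exists (2 * N')%N.
have N'n : (N' <= n)%N by apply: leq_trans nN; rewrite leq_pmull.
have Kn : (K <= n)%N by apply: leq_trans N'n; rewrite leq_maxr.
rewrite ger0_norm ?mulr_ge0 ?q0//.
have : (n - N')%:R * q n <= S n - S N'.
  rewrite /S (@big_cat_nat _ _ _ N')//=; last by rewrite leq_maxr.
  rewrite addrAC subrr add0r mulr_natl -sumr_const_nat !big_nat.
  apply: ler_sum => k /andP[Nk kn]; apply: mono (ltnW kn).
  by apply: leq_trans Nk; rewrite leq_maxr.
have := SN N' (leq_maxl _ _); have := SN n (leq_trans (leq_maxl _ _) N'n).
rewrite !ler_norml => /andP[h1 h2] /andP[h3 h4] h5.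
have : n%:R * q n <= 2 * ((n - N')%:R * q n); last by lra.
rewrite mulrA ler_wpM2r ?q0// -natrM ler_nat.
by rewrite mulnBr mul2n -addnn -addnBA ?leq_addr.
Unshelve. all: by end_near. Qed.

(** A sequence whose increments are controlled by [c * mu k * (h k.+1 - h k)],
    with [mu] the decrements of a convex null sequence and [h] bounded, is a
    nonincreasing sequence up to corrections that are summable as well:
    summation by parts moves the difference from [h] to [mu]. *)
Lemma summable_residual_rate K w h eps (c C M : R) : 0 <= c -> 0 <= C ->
  (forall k, 0 <= eps k) -> (forall k, eps k.+1 <= eps k) ->
  (forall k, eps k.+1 - eps k.+2 <= eps k - eps k.+1) ->
  (forall k, 0 <= w k) -> (forall k, `|h k| <= M) ->
  (forall k, (K <= k)%N -> w k.+1 <= w k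
     + c * (eps k - eps k.+1) * (h k.+1 - h k) + C * (eps k - eps k.+1) ^+ 2) ->
  bounded_sums K w -> k%:R * w k @[k --> \oo] --> (0 : R).
Proof.
move=> c0 C0 eps0 deps ceps w0 hM step sw.
pose mu k := eps k - eps k.+1.
have mu0 k : 0 <= mu k by rewrite subr_ge0.
(* [M - h k >= 0], so replacing [mu k] by [mu k.+1 <= mu k] in the second term
   is a decrease; the third one absorbs [C * mu k ^+ 2]. *)
pose q k := w k + c * mu k * (M - h k) + C * (mu k * eps k).
have hM' k : 0 <= M - h k <= 2 * M.
  by have := hM k; rewrite ler_norml => /andP[]; lra.
have qw k : w k <= q k.
  have /andP[h0 _] := hM' k.
  by rewrite /q -addrA lerDl addr_ge0// !mulr_ge0.
have q_cvg : k%:R * q k @[k --> \oo] --> (0 : R).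
  apply: (@nonincreasing_summable K).
  - by move=> k _; exact: le_trans (qw k).
  - move=> k Kk; have := step k Kk; rewrite -/(mu k) /q.
    have : c * mu k.+1 * (M - h k.+1) <= c * mu k * (M - h k.+1).
      have /andP[h0 _] := hM' k.+1.
      by rewrite ler_wpM2r// ler_wpM2l// /mu ceps.
    have : C * (mu k.+1 * eps k.+1) <= C * (mu k * eps k.+1).
      by rewrite ler_wpM2l// ler_wpM2r// /mu ceps.
    by rewrite [C * mu k ^+ 2](_ : _ = C * (mu k * eps k) - C * (mu k * eps k.+1));
      [lra|rewrite /mu; ring].
  - apply: bounded_sumsD; first apply: bounded_sumsD => //.
      apply: (@bounded_sums_le _ _ mu (c * (2 * M))).
      + by have /andP[/le_trans + h2] := hM' 0%N => /(_ _ h2) ?; rewrite mulr_ge0.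
      + move=> k _; have /andP[_ h2] := hM' k.
        by have := ler_wpM2l c0 (ler_wpM2l (mu0 k) h2); lra.
      + exact: bounded_sums_telescope.
    apply: (@bounded_sums_le _ _ mu (C * eps 0%N)); first by rewrite mulr_ge0.
    + move=> k _; rewrite mulrA mulrAC ler_wpM2r// ler_wpM2l//.
      by elim: k => // k IH; exact: le_trans IH.
    + exact: bounded_sums_telescope.
apply: (squeeze_cvgr _ (cvg_cst 0) q_cvg).
by apply: nearW => k; rewrite mulr_ge0//= ler_wpM2l.
Qed.

End real_sequences.

(** * The extragradient step *)

Section extragradient_step.
Context {R : realType} {V : innerType R}.
Implicit Types (z zb zn w T Tb Tn xi xib xin g : V).

(** [T], [Tb], [Tn] and [xi], [xib], [xin] stand for the values of the monotone
    operator and for subgradients at the current, the intermediate and the next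
    point. *)
Lemma step_energy (s q fb fn fw : R) z zb zn w T Tb xib xin :
  0 < s -> 0 < q ->
  zb = z - s *: (T + xib) -> zn = z - s *: (Tb + xin) ->
  fn + '[xin, w - zn] <= fw -> fb + '[xib, zn - zb] <= fn ->
  s ^+ 2 * '[T - Tb, T - Tb] <= q ^+ 2 * '[z - zb, z - zb] ->
  '[zn - w, zn - w] + (1 - q) * ('[z - zb, z - zb] + '[zn - zb, zn - zb])
    + 2 * s * (fb - fw + '[Tb, zb - w]) <= '[z - w, z - w].
Proof.
move=> s0 q0 zbE znE subn subb lip.
pose a := z - zb; pose b := zn - zb; pose y := zb - w.
have sxib : s *: xib = a - s *: T.
  by rewrite /a zbE opprD addNKr opprK scalerDr addrC addKr.
have sxin : s *: xin = a - b - s *: Tb.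
  rewrite /a /b opprB addrA subrK znE opprD addNKr opprK scalerDr.
  by rewrite addrC addKr.
have zw : z - w = a + y by rewrite /a /y addrA subrK.
have znw : zn - w = b + y by rewrite /b /y addrA subrK.
have wzn : w - zn = - (b + y) by rewrite -znw opprB.
rewrite zw znw -/a -/b -/y; rewrite -/a in lip; rewrite wzn in subn; rewrite -/b in subb.
have qV0 : 0 < q^-1 by rewrite invr_gt0.
have := inner_young (s *: (T - Tb)) b qV0; rewrite invrK => young.
have lip' : q^-1 * '[s *: (T - Tb), s *: (T - Tb)] <= q * '[a, a].
  by rewrite innerZl innerZr mulrC ler_pdivrMr//; lra.
have := ler_wpM2l (ltW s0) subn; have := ler_wpM2l (ltW s0) subb.
rewrite !mulrDr -!innerZl sxib sxin; move: young lip'.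
clearbody a b y.
by rewrite !innerE (innerC y a) (innerC y b); lra.
Qed.

(** The residual at the next point does not exceed the one at the current point.
    The inequality uses that subgradients of one function at three points are
    cyclically monotone, which is more than monotonicity. *)
Lemma step_residual (s q f fb fn : R) z zb zn T Tb Tn xi xib xin :
  0 < s ->
  zb = z - s *: (T + xib) -> zn = z - s *: (Tb + xin) ->
  f + '[xi, zb - z] <= fb -> fb + '[xib, zn - zb] <= fn ->
  fn + '[xin, z - zn] <= f ->
  0 <= '[Tn - T, zn - z] ->
  s ^+ 2 * '[Tn - Tb, Tn - Tb] <= q ^+ 2 * '[zn - zb, zn - zb] ->
  '[Tn + xin, Tn + xin] + '[xi - xib, xi - xib]
    + (1 - q ^+ 2) * '[T + xib - (Tb + xin), T + xib - (Tb + xin)]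
    <= '[T + xi, T + xi].
Proof.
move=> s0 zbE znE sub subb subn mono lip.
have dzb : zb - z = - s *: (T + xib) by rewrite zbE addrAC subrr add0r scaleNr.
have dzn : zn - z = - s *: (Tb + xin) by rewrite znE addrAC subrr add0r scaleNr.
have dnb : zn - zb = s *: (T + xib - (Tb + xin)).
  have -> : zn - zb = (zn - z) - (zb - z) by rewrite opprB addrA subrK.
  by rewrite dzb dzn scaleNr scaleNr opprK addrC scalerBr.
rewrite dzb in sub; rewrite dnb in subb lip; rewrite dzn in mono.
rewrite -opprB dzn in subn.
have cyc : 0 <= '[xi, T + xib] - '[xib, T + xib - (Tb + xin)] - '[xin, Tb + xin].
  rewrite -(pmulr_rge0 _ s0); move: sub subb subn; rewrite !innerE; lra.
have mono' : '[Tn - T, Tb + xin] <= 0.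
  by rewrite -oppr_ge0 -(pmulr_rge0 _ s0); move: mono; rewrite !innerE; lra.
have lip' : '[Tn - Tb, Tn - Tb]
    <= q ^+ 2 * '[T + xib - (Tb + xin), T + xib - (Tb + xin)].
  rewrite -(ler_pM2l (exprn_gt0 2 s0)); apply: le_trans lip _.
  by rewrite innerZl innerZr; lra.
move: lip' mono' cyc; rewrite mulrBl mul1r.
move: (q ^+ 2 * _) => t; rewrite !innerE.
rewrite ?(innerC Tb Tn) ?(innerC xin Tn) ?(innerC xin T) ?(innerC xin Tb).
rewrite ?(innerC xin xi) ?(innerC xin xib) ?(innerC xib T) ?(innerC xib Tb).
by rewrite ?(innerC xib xi) ?(innerC xi T) ?(innerC Tb T); lra.
Qed.

(** The same step when the residual at the current point was formed with a
    parameter larger by [mu], whose contribution is [mu *: g]. The increment is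
    controlled by [hn - h] because the leading part of the residual is
    [s^-1 *: (z - zn)] and [g] is a subgradient at [z], not at [zn]. *)
Lemma step_residual_change (s q f fb fn mu h hn : R) z zb zn T Tb Tn xi xib xin g :
  0 < s -> 0 <= q < 1 -> 0 <= mu ->
  zb = z - s *: (T + xib) -> zn = z - s *: (Tb + xin) ->
  f + '[xi, zb - z] <= fb -> fb + '[xib, zn - zb] <= fn ->
  fn + '[xin, z - zn] <= f ->
  0 <= '[Tn - T, zn - z] ->
  s ^+ 2 * '[Tn - Tb, Tn - Tb] <= q ^+ 2 * '[zn - zb, zn - zb] ->
  h + '[g, zn - z] <= hn ->
  '[Tn + xin, Tn + xin] <= '[T + xi + mu *: g, T + xi + mu *: g]
    + 2 / s * mu * (hn - h) + (1 - q ^+ 2)^-1 * '[g, g] * mu ^+ 2.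
Proof.
move=> s0 /andP[q0 q1] mu0 zbE znE sub subb subn mono lip hg.
have := step_residual s0 zbE znE sub subb subn mono lip.
have dzn : zn - z = - s *: (Tb + xin) by rewrite znE addrAC subrr add0r scaleNr.
have hg' : - '[g, Tb + xin] <= s^-1 * (hn - h).
  rewrite ler_pdivlMl// mulrN -innerZr -innerNr -scaleNr -dzn; lra.
have q2 : 0 < 1 - q ^+ 2 by rewrite subr_gt0 expr_lt1.
have TE : T + xi = (Tb + xin) + ((xi - xib) + (T + xib - (Tb + xin))).
  rewrite [RHS]addrCA (addrC (Tb + xin)) subrK.
  by rewrite addrACA addNr addr0 addrC.
have TEg : '[T + xi, g] = '[g, Tb + xin] + '[g, xi - xib]
    + '[g, T + xib - (Tb + xin)].
  by rewrite (innerC _ g) {1}TE !innerDr; lra.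
have := inner_young (- mu *: g) (xi - xib) ltr01; rewrite invr1 !mul1r.
have := inner_young (T + xib - (Tb + xin)) (- mu *: g) q2.
move: (T + xi) (Tb + xin) (xi - xib) (T + xib - (Tb + xin)) hg' TEg.
move=> w b v y hg' TEg.
have := ler_wpM2l mu0 hg'; rewrite (innerDl w) !(innerDr _ w) !innerZl !innerZr.
rewrite (innerC g w) TEg (innerC y g).
by move: (1 - q ^+ 2)^-1 (1 - q ^+ 2) s^-1 => p p' s'; lra.
Qed.

End extragradient_step.

(** * The iteration with vanishing parameter *)

Section iteration.
Context {R : realType} {V : innerType R}.
Context (B D : V -> V) (phi psi : V -> \bar R) (hh : V -> R).
Context (eps : nat -> R) (s q : R) (K : nat).
Context (z zb xi eta zetab : nat -> V).

(* The operator and the smooth part of the inner problem at step [k]. *)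
Let T k u := B u + eps k *: D u.

Context (s0 : 0 < s) (q0 : 0 < q) (q1 : q < 1).
Context (eps0 : forall k, 0 < eps k) (eps_dec : forall k, eps k.+1 <= eps k).
Context (phiN : forall u, phi u != -oo%E) (psiN : forall u, psi u != -oo%E).
Context (B_mono : forall u v, 0 <= '[B u - B v, u - v]).
Context (hh_grad : forall u v, hh u + '[D u, v - u] <= hh v).
Context (T_lip : forall k u v, (K <= k)%N ->
  s ^+ 2 * '[T k u - T k v, T k u - T k v] <= q ^+ 2 * '[u - v, u - v]).
Context (xi_in : forall k, subdiff phi (z k.+1) (xi k.+1)).
Context (eta_in : forall k, subdiff psi (z k.+1) (eta k.+1)).
Context (zetab_in : forall k,
  subdiff (fun u => phi u + (eps k)%:E * psi u)%E (zb k) (zetab k)).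
Context (zb_def : forall k, zb k = z k - s *: (T k (z k) + zetab k)).
Context (z_def : forall k,
  z k.+1 = z k - s *: (T k (zb k) + (xi k.+1 + eps k *: eta k.+1))).

Let Phi k u : \bar R := (phi u + (eps k)%:E * psi u)%E.

Lemma fin_split k u : Phi k u \is a fin_num -> phi u \is a fin_num /\ psi u \is a fin_num.
Proof.
rewrite /Phi; have := phiN u; have := psiN u; have := eps0 k.
by case: (phi u) (psi u) => [a| |] [b| |]//= ek _ _; rewrite gt0_muley ?lte_fin.
Qed.

Lemma PhiE k u : phi u \is a fin_num -> psi u \is a fin_num ->
  Phi k u = (fine (phi u) + eps k * fine (psi u))%:E.
Proof. by rewrite /Phi EFinD EFinM => /fineK -> /fineK ->. Qed.

Lemma zb_fin k : phi (zb k) \is a fin_num /\ psi (zb k) \is a fin_num.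
Proof. exact: fin_split (zetab_in k).1. Qed.

Lemma z_fin k : phi (z k.+1) \is a fin_num /\ psi (z k.+1) \is a fin_num.
Proof. by split; [exact: (xi_in k).1 | exact: (eta_in k).1]. Qed.

Lemma D_mono u v : 0 <= '[D u - D v, u - v].
Proof.
by have := hh_grad u v; have := hh_grad v u; rewrite !innerE; lra.
Qed.

Lemma T_mono k u v : 0 <= '[T k u - T k v, u - v].
Proof.
rewrite /T opprD addrACA -scalerBr innerDl innerZl addr_ge0 ?B_mono//.
by rewrite mulr_ge0 ?D_mono// ltW.
Qed.

Lemma zeta_in j k : subdiff (Phi j) (z k.+1) (xi k.+1 + eps j *: eta k.+1).
Proof. exact: subdiff_add (ltW (eps0 j)) (xi_in k) (eta_in k). Qed.

Let steps k := '[z k - zb k, z k - zb k] + '[z k.+1 - zb k, z k.+1 - zb k].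

Lemma steps_ge0 k : 0 <= steps k.
Proof. by rewrite addr_ge0 ?inner_ge0. Qed.

(** Quasi-Fejer monotonicity with respect to [zs], when the gap function at [zs]
    of the step-[k] problem is bounded below by [- b k]. *)
Lemma iteration_fejer zs (b : nat -> R) :
  phi zs \is a fin_num -> psi zs \is a fin_num ->
  (forall k, 0 <= b k) -> bounded_sums K b ->
  (forall k w, (K <= k)%N -> phi w \is a fin_num -> psi w \is a fin_num ->
    - b k <= '[B w, w - zs] + fine (phi w) - fine (phi zs)
      + eps k * (hh w + fine (psi w) - hh zs - fine (psi zs))) ->
  cvg ('[z k - zs, z k - zs] @[k --> \oo]) /\ bounded_sums K steps.
Proof.
move=> phis psis b0 sb gap.
have [|k Kk|//|zcvg [M uM]] := @quasi_fejer _ K (fun k => '[z k - zs, z k - zs])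
    (fun k => 2 * s * b k) (fun k => (1 - q) * steps k); last 1 first.
- split=> //; apply: (@bounded_sums_le _ _ _ (fun k => (1 - q) * steps k) (1 - q)^-1).
  + by rewrite invr_ge0 subr_ge0 ltW.
  + by move=> k _; rewrite mulKf// gt_eqF// subr_gt0.
  + by exists M.
- move=> k _; split; first exact: inner_ge0.
  + by rewrite mulr_ge0// mulr_ge0// ltW.
  + by rewrite mulr_ge0 ?steps_ge0// subr_ge0 ltW.
- have [phib psib] := zb_fin k; have [phin psin] := z_fin k.
  have subn := subdiff_ge (zeta_in k k) (PhiE k phin psin) (PhiE k phis psis).
  have subb := subdiff_ge (zetab_in k) (PhiE k phib psib) (PhiE k phin psin).
  have := step_energy s0 q0 (zb_def k) (z_def k) subn subb (T_lip _ _ Kk).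
  rewrite -/(steps k); have := gap k _ Kk phib psib.
  have : eps k * (hh (zb k) - hh zs) <= eps k * '[D (zb k), zb k - zs].
    rewrite ler_wpM2l ?(ltW (eps0 k))//.
    by have := hh_grad (zb k) zs; rewrite -(opprB zs) innerNr; lra.
  rewrite /T (innerDl (B (zb k))) innerZl.
  move: '[B _, _] '[D _, _] => x y h1 h2 h3.
  have : 0 <= s * (b k + (x + fine (phi (zb k)) - fine (phi zs)
      + eps k * (y + fine (psi (zb k)) - fine (psi zs)))).
    by rewrite mulr_ge0 ?(ltW s0)//; lra.
  by lra.
- apply: (@bounded_sums_le _ _ _ b (2 * s)) => //.
  by rewrite mulr_ge0// ltW.
Qed.

(* Index [k] refers to the point [z k.+1], whose subgradients come from a
   step taken with the parameter [eps k]. *)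
Let g k := D (z k.+1) + eta k.+1.
Let W k := B (z k.+1) + xi k.+1 + eps k *: g k.
Let h k := hh (z k.+1) + fine (psi (z k.+1)).

(** The residual at [z k.+1] is a Lipschitz increment of the operator plus the
    full step divided by [s]. *)
Lemma residual_summable : bounded_sums K steps -> bounded_sums K (fun k => '[W k, W k]).
Proof.
move=> ss; apply: (@bounded_sums_le _ _ _ steps (6 / s ^+ 2)) => //.
  by rewrite divr_ge0// sqr_ge0.
move=> k Kk; have WE : s *: W k = s *: (T k (z k.+1) - T k (zb k)) + (z k - z k.+1).
  rewrite {2}z_def opprB (addrCA (z k)) subrr addr0 -scalerDr; congr (_ *: _).
  by rewrite addrA subrK /W /g /T scalerDr addrACA.
have lip := T_lip (z k.+1) (zb k) Kk.
rewrite mulrAC ler_pdivlMr ?exprn_gt0//.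
have -> : '[W k, W k] * s ^+ 2 = '[s *: W k, s *: W k].
  by rewrite innerZl innerZr; lra.
rewrite WE /steps.
have -> : z k - z k.+1 = (z k - zb k) - (z k.+1 - zb k).
  by rewrite opprB addrA subrK.
move: lip; move: (T k _ - T k _) (z k - zb k) (z k.+1 - zb k) => t x y tle.
have q2 : q ^+ 2 <= 1 by rewrite expr_le1// ltW.
have := ler_wpM2r (inner_ge0 y) q2.
have := inner_ge0 (s *: t - (x - y)); have := inner_ge0 (x + y).
have := inner_ge0 x; have := inner_ge0 y.
rewrite !innerE (innerC y x) (innerC x t) (innerC y t); lra.
Qed.

(** The subgradients at all three points of step [k.+1] are formed with
    [eps k.+1], whereas [W k] carries [eps k]: the residual inequality is applied
    with the change [mu = eps k - eps k.+1]. *)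
Lemma iteration_rate (M1 M2 : R) :
  (forall k, eps k.+1 - eps k.+2 <= eps k - eps k.+1) ->
  bounded_sums K steps -> (forall k, '[g k, g k] <= M1) ->
  (forall k, `|h k| <= M2) ->
  k%:R * '[W k, W k] @[k --> \oo] --> (0 : R).
Proof.
move=> eps_cvx ss gM hM.
have q2 : 0 < 1 - q ^+ 2 by rewrite subr_gt0 expr_lt1// ltW.
have M10 : 0 <= M1 by exact: le_trans (inner_ge0 (g 0%N)) (gM _).
apply: (@summable_residual_rate _ K _ h eps (2 / s) ((1 - q ^+ 2)^-1 * M1) M2) => //.
- by rewrite divr_ge0// ltW.
- by rewrite mulr_ge0// invr_ge0 ltW.
- by move=> k; exact: ltW.
- by move=> k; exact: inner_ge0.
- move=> k Kk; pose j := k.+1.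
  have mu0 : 0 <= eps k - eps j by rewrite subr_ge0; exact: eps_dec.
  have [phib psib] := zb_fin j; have [phin psin] := z_fin j.
  have [phi1 psi1] := z_fin k.
  have sub := subdiff_ge (zeta_in j k) (PhiE j phi1 psi1) (PhiE j phib psib).
  have subb := subdiff_ge (zetab_in j) (PhiE j phib psib) (PhiE j phin psin).
  have subn := subdiff_ge (zeta_in j j) (PhiE j phin psin) (PhiE j phi1 psi1).
  have hg : h k + '[g k, z j.+1 - z j] <= h j.
    rewrite /h /g innerDl.
    have := hh_grad (z j) (z j.+1).
    have := subdiff_ge (eta_in k) (esym (fineK psi1)) (esym (fineK psin)).
    by rewrite -/j; lra.
  have Kj : (K <= j)%N by exact: leqW.
  have qq : 0 <= q < 1 by rewrite ltW//.
  have := step_residual_change s0 qq mu0 (zb_def j) (z_def j) sub subb subn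
    (T_mono j _ _) (T_lip _ _ Kj) hg.
  have -> : T j (z j.+1) + (xi j.+1 + eps j *: eta j.+1) = W j.
    by rewrite /T /W /g scalerDr addrACA.
  have -> : T j (z k.+1) + (xi k.+1 + eps j *: eta k.+1) + (eps k - eps j) *: g k
      = W k.
    rewrite /T /W /g addrACA -scalerDr -[LHS]addrA; congr (_ + _).
    by rewrite -scalerDl (addrC (eps j)) subrK.
  move=> /le_trans; apply.
  by rewrite lerD2l ler_wpM2r ?sqr_ge0// ler_wpM2l// invr_ge0 ltW.
- exact: residual_summable.
Qed.

(** * The bilevel problem: growth of the gap function *)

Let Kb u : \bar R := ((hh u)%:E + psi u)%E.
Let Z := vi_zeros B phi.
Let sol := bilevel_sol B phi Kb.
Let Hr u : R := hh u + fine (psi u).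
Let F zs w : R := '[w - zs, B w] + fine (phi w) - fine (phi zs).

Context (qual : forall zs, sol zs -> op_add (subdiff Kb) (normal_cone Z) zs 0).

Lemma KbE u : psi u \is a fin_num -> Kb u = (Hr u)%:E.
Proof. by rewrite /Kb /Hr EFinD => /fineK ->. Qed.

Lemma sol_fin zs : sol zs -> phi zs \is a fin_num /\ psi zs \is a fin_num.
Proof.
move=> szs; have [/vi_zerosP[phis _] _] := szs; split=> //.
have [p [+ _] _] := qual szs; rewrite /Kb; have := psiN zs.
by case: (psi zs).
Qed.

Lemma sol_multiplier zs : sol zs -> exists2 ps, normal_cone Z zs ps &
  forall w, psi w \is a fin_num -> Hr zs - '[ps, w - zs] <= Hr w.
Proof.
move=> szs; have [_ psis] := sol_fin szs.
have [p ps [n Nn pn]] := qual szs; exists n => // w psiw.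
have pE : p = - n by apply/eqP; rewrite -addr_eq0 pn.
by rewrite -innerNl -pE (subdiff_ge ps (KbE psis) (KbE psiw)).
Qed.

Lemma gap_ge0 zs w : Z zs -> phi w \is a fin_num -> 0 <= F zs w.
Proof.
move=> /vi_zerosP sub phiw.
have := subdiff_ge sub (esym (fineK sub.1)) (esym (fineK phiw)).
have := B_mono w zs; rewrite /F (innerC (w - zs)) innerDl !innerNl; lra.
Qed.

Lemma gap_funE zs w : phi zs \is a fin_num -> phi w \is a fin_num ->
  gap_fun B phi zs w = (F zs w)%:E.
Proof. by rewrite /gap_fun /F !EFinD EFinN => /fineK -> /fineK ->. Qed.

(** What both growth conditions provide: the gap function, tilted by the
    multiplier, is bounded below by the terms of a summable sequence. *)
Let gap_summable := forall zs, sol zs -> forall ps, normal_cone Z zs ps ->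
  exists b : nat -> R, [/\ forall k, 0 <= b k, bounded_sums K b &
    forall k w, phi w \is a fin_num -> - b k <= F zs w - eps k * '[ps, w - zs]].

(** A multiplier is normal to [Z] at [zs], so the support function at
    [eps k *: ps] is attained at [zs]. Each term of the series is then the
    supremum of [eps k * '[ps, w - zs] - F zs w] over [w], and it is nonnegative
    by the choice [w = zs]. *)
Lemma attouch_czarnecki_gap : attouch_czarnecki B phi Kb eps -> gap_summable.
Proof.
move=> ac zs szs ps Nps; have [phis psis] := sol_fin szs.
pose S k := support_fun Z (eps k *: ps).
have SE k : S k = (eps k * '[ps, zs])%:E.
  apply/eqP; rewrite eq_le; apply/andP; split.
    apply: ge_ereal_sup => _ [w Zw <-].
    rewrite lee_fin innerZr ler_wpM2l ?(ltW (eps0 k))//.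
    by have := Nps w Zw; rewrite innerDr innerNr (innerC w); lra.
  apply: ereal_sup_ubound; exists zs; first exact: szs.1.
  by rewrite innerZr innerC.
pose t k : \bar R := (fenchel_conj (gap_fun B phi zs) (eps k *: ps) - S k)%E.
have t_ge k w : phi w \is a fin_num ->
    ((eps k * '[ps, w - zs] - F zs w)%:E <= t k)%E.
  move=> phiw; rewrite /t SE leeBrDr// -EFinD.
  have := fenchel_young (gap_fun B phi zs) (eps k *: ps) w.
  rewrite gap_funE// -EFinB; apply: le_trans.
  by rewrite lee_fin innerZl innerDr innerNr; lra.
have t0 k : (0 <= t k)%E.
  apply: le_trans (t_ge k zs phis); rewrite lee_fin /F !subrr inner0l inner0r.
  lra.
have tfin k : t k \is a fin_num.
  rewrite ge0_fin_numE//; apply: le_lt_trans (ac zs szs ps Nps).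
  apply: (@le_trans _ _ (\sum_(0 <= i < k.+1) t i)%E).
    by rewrite big_nat_recr//= leeDr// sume_ge0.
  by apply: nneseries_lim_ge => n _ _; exact: t0.
exists (fine \o t); split=> [k|| k w phiw] /=.
- by rewrite fine_ge0.
- exists (fine (\sum_(0 <= k <oo) t k)%E) => n.
  apply: (@le_trans _ _ (\sum_(0 <= k < n) fine (t k))).
    have [Kn|nK] := leqP K n; last first.
      by rewrite big_geq ?(ltnW nK)// sumr_ge0// => k _; rewrite fine_ge0.
    rewrite (@big_cat_nat _ _ _ K 0%N n)//= lerDr sumr_ge0// => k _.
    by rewrite fine_ge0.
  rewrite -lee_fin fineK; last first.
    by rewrite ge0_fin_numE ?nneseries_ge0//; exact: (ac zs szs ps Nps).
  rewrite -sumEFin; under eq_bigr do rewrite fineK//.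
  by apply: nneseries_lim_ge.
- by have := t_ge k w phiw; rewrite -(fineK (tfin k)) lee_fin; lra.
Qed.

Lemma dist_bound zs ps w (d : R) : normal_cone Z zs ps -> idist w Z = d%:E ->
  '[ps, w - zs] <= inorm ps * d.
Proof.
move=> Nps dE; have key v : Z v -> '[ps, w - zs] <= inorm ps * inorm (w - v).
  move=> Zv; have := Nps v Zv; have := cauchy_schwarz ps (w - v).
  by rewrite !innerDr !innerNr; lra.
have [N0|N0] := eqVneq (inorm ps) 0.
  have [v Zv] : exists v, Z v.
    apply: contrapT => nZ; move: dE; rewrite /idist (_ : [set _ | _ in _] = set0).
      by rewrite ereal_inf0.
    by apply/seteqP; split=> // y [v Zv _]; apply: nZ; exists v.
  by have := key v Zv; rewrite N0 !mul0r.
have N1 : 0 < inorm ps by rewrite lt_def N0 inorm_ge0.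
rewrite -ler_pdivrMl// -lee_fin -dE; apply: le_ereal_inf_tmp => _ [v Zv <-].
by rewrite lee_fin ler_pdivrMl// key.
Qed.

(** The sharpness term and the linear term balance at distance
    [(e * inorm ps * rho / tau) `^ (rho - 1)^-1]: beyond it the former dominates,
    below it the latter is of order [e `^ (rho / (rho - 1))]. *)
Lemma sharpness_gap rho zs ps : 1 < rho -> sharpness B phi Kb rho -> sol zs ->
  normal_cone Z zs ps -> exists2 C : R, 0 <= C & forall e w, 0 < e ->
    phi w \is a fin_num ->
    - (C * e `^ (rho / (rho - 1))) <= F zs w - e * '[ps, w - zs].
Proof.
move=> rho1 sh szs Nps; have [tau [tau0 tauF]] := sh zs szs.
have [phis psis] := sol_fin szs.
set N := inorm ps; have N0 : 0 <= N by exact: inorm_ge0.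
pose r := rho - 1; have r0 : 0 < r by rewrite subr_gt0.
have rho0 : 0 < rho by rewrite (lt_trans ltr01).
pose M := N * rho / tau.
have M0 : 0 <= M by rewrite divr_ge0 ?mulr_ge0 ?(ltW rho0) ?(ltW tau0).
exists (N * M `^ r^-1); first by rewrite mulr_ge0 ?powR_ge0.
move=> e w e0 phiw.
have dge0 : (0 <= idist w Z)%E.
  by apply: le_ereal_inf_tmp => _ [v _ <-]; rewrite lee_fin inorm_ge0.
have [d dE] : exists d, idist w Z = d%:E.
  have : (idist w Z <= (inorm (w - zs))%:E)%E.
    by apply: ereal_inf_lbound; exists zs => //; exact: szs.1.
  by move: dge0; case: (idist w Z) => // d _ _; exists d.
have d0 : 0 <= d by rewrite -lee_fin -dE.
have := tauF w; rewrite dE gap_funE// poweR_EFin -EFinM lee_fin => Fd.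
have psd := dist_bound Nps dE; rewrite -/N in psd.
have Fw := gap_ge0 szs.1 phiw.
have eps_ps : e * '[ps, w - zs] <= e * N * d by rewrite -mulrA ler_wpM2l// ltW.
pose d1 := (e * M) `^ r^-1.
have [dd1|d1d] := leP d d1.
  have : e * N * d <= e * N * d1 by rewrite ler_wpM2l// mulr_ge0// ltW.
  have -> : e * N * d1 = N * M `^ r^-1 * e `^ (rho / r).
    rewrite /d1 powRM// ?(ltW e0)//.
    have -> : rho / r = 1 + r^-1 by rewrite /r; field; rewrite gt_eqF.
    rewrite powRD; last by rewrite (gt_eqF e0) implybT.
    by rewrite powRr1 ?(ltW e0)//; ring.
  lra.
have dpos : 0 < d by apply: le_lt_trans d1d; exact: powR_ge0.
have Mr : e * M <= d `^ r.
  have -> : e * M = d1 `^ r.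
    by rewrite /d1 -powRrM mulVf ?gt_eqF// powRr1// mulr_ge0// ltW.
  by rewrite ge0_ler_powR ?nnegrE ?powR_ge0 ?(ltW r0) ?(ltW d1d) ?d0.
have : e * N * d <= tau / rho * d `^ rho.
  have -> : d `^ rho = d `^ r * d.
    rewrite -[X in _ = _ * X](powRr1 d0) -powRD ?subrK//.
    by rewrite (gt_eqF dpos) implybT.
  rewrite mulrA ler_wpM2r//.
  have -> : e * N = tau / rho * (e * M).
    by rewrite /M; field; rewrite !gt_eqF.
  by rewrite ler_wpM2l// divr_ge0// ltW.
have : 0 <= N * M `^ r^-1 * e `^ (rho / r) by rewrite !mulr_ge0 ?powR_ge0.
lra.
Qed.

(** * The bilevel problem: convergence *)

Context (L Lh : R) (phi_cvx : econvex phi).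
Context (phi_sup : sup_affine phi) (psi_sup : sup_affine psi) (rV : riesz_space V).
Context (B_lip : forall u v, inorm (B u - B v) <= L * inorm (u - v)).
Context (D_lip : forall u v, inorm (D u - D v) <= Lh * inorm (u - v)).
Context (eta_bounded : forall M : R, (forall k, inorm (z k) <= M) ->
  exists G : R, forall k, inorm (eta k.+1) <= G).
Context (eps_cvx : forall k, eps k.+1 - eps k.+2 <= eps k - eps k.+1).
Context (eps_cvg : eps k @[k --> \oo] --> (0 : R)).

Let y k := z k.+1.
Let res k := B (y k) + xi k.+1.

(** Monotonicity replaces [B (y k)] by [B w] in the subgradient inequality at
    [y k]; every remaining term passes to the weak limit, through the affine
    minorants of [phi], and Minty's lemma applies. *)
Lemma weak_limit_zero (U : set_system nat) (M : R) p : ProperFilter U ->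
  \oo `<=` U -> (forall w, '[y k, w] @[k --> U] --> '[p, w]) ->
  (forall k, inorm (y k) <= M) -> inorm (res k) @[k --> \oo] --> (0 : R) -> Z p.
Proof.
move=> PU oU yp yM res0.
have key w b c : phi w = b%:E -> (c%:E < phi p)%E -> c <= b + '[B w, w - p].
  move=> wb /phi_sup[l [be [lmin cl]]]; apply: ltW; apply: lt_le_trans cl _.
  suff : '[p, l + B w] <= b + '[B w, w] - be.
    by rewrite (innerC p) innerDl innerDr innerNr; lra.
  apply: (@ler_cvg_to _ (U : set_system nat) _ _ (fun k => '[y k, l + B w])
    (fun k => b + '[B w, w] - be + inorm (res k) * (inorm w + M))).
  - exact: yp.
  - rewrite -[X in _ --> X]addr0; apply: cvgD; first exact: cvg_cst.
    rewrite -(mul0r (inorm w + M)); apply: cvgMl.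
    by move=> A A0; apply: oU; exact: res0.
  - apply: nearW => k; have [phiy _] := z_fin k.
    have h1 := subdiff_ge (xi_in k) (esym (fineK phiy)) wb.
    have h2 := B_mono w (y k).
    have h3 : '[res k, y k - w] <= inorm (res k) * (inorm w + M).
      apply: le_trans (cauchy_schwarz _ _) _; rewrite ler_wpM2l ?inorm_ge0//.
      by apply: le_trans (ler_inormB _ _) _; rewrite addrC lerD2l.
    have := lmin (y k); rewrite -(fineK phiy) lee_fin => h4.
    move: h1 h2 h3 h4; rewrite -/(y k) /res !innerE.
    by rewrite (innerC (y k) l) (innerC (y k) (B w)); lra.
have phip : phi p \is a fin_num.
  have phib := (zb_fin 0).1.
  have [pE|[r ->]//] := ereal_cases (phiN p).
  have := key _ _ (fine (phi (zb 0)) + '[B (zb 0), zb 0 - p] + 1) (esym (fineK phib)).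
  by rewrite pE ltry => /(_ isT); lra.
apply/vi_zerosP; apply: (minty phiN phi_cvx B_lip phip) => w.
have [->|[b bE]] := ereal_cases (phiN w); first by rewrite leey.
rewrite bE -(fineK phip) -EFinD lee_fin; apply/ler_addgt0Pr => e e0.
have := key w b (fine (phi p) - e) bE; rewrite -(fineK phip) lte_fin /=.
by move=> h'; have := h' ltac:(lra); lra.
Qed.

(** Both parts of the upper level objective are weakly lower semicontinuous:
    [psi] through its affine minorants, [hh] through its gradient inequality. *)
Lemma weak_limit_sol (U : set_system nat) zs p : ProperFilter U ->
  \oo `<=` U -> (forall w, '[y k, w] @[k --> U] --> '[p, w]) ->
  sol zs -> Z p ->
  (forall e, 0 < e -> \forall k \near \oo, h k <= Hr zs + e) -> sol p.
Proof.
move=> PU oU yp szs Zp hle; have [phis psis] := sol_fin szs.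
have key c : (c%:E < psi p)%E -> c + hh p <= Hr zs.
  move=> /psi_sup[l [be [lmin cl]]]; apply/ler_addgt0Pr => e e0.
  suff : '[p, l + D p] <= Hr zs + e - hh p - be + '[D p, p].
    by rewrite (innerC p) innerDl; lra.
  apply: (@ler_cvg_to _ (U : set_system nat) _ _ (fun k => '[y k, l + D p])
    (fun=> Hr zs + e - hh p - be + '[D p, p])); first exact: yp.
    exact: cvg_cst.
  apply: oU; apply: filterS (hle e e0) => k; have [_ psiy] := z_fin k.
  have := lmin (y k); rewrite -(fineK psiy) lee_fin.
  have := hh_grad p (y k); rewrite /h -/(y k) innerDr innerNr.
  by rewrite innerDr (innerC l) (innerC (D p)); lra.
split=> // w Zw; apply: le_trans (szs.2 w Zw); rewrite (KbE psis).
have psip : psi p \is a fin_num.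
  have [pE|[r ->]//] := ereal_cases (psiN p).
  by have := key (Hr zs - hh p + 1); rewrite pE ltry => /(_ isT); lra.
rewrite (KbE psip) lee_fin; apply/ler_addgt0Pr => e e0.
have := key (fine (psi p) - e); rewrite -(fineK psip) lte_fin /Hr /=.
by move=> h'; have := h' ltac:(lra); lra.
Qed.

Lemma iterates_bounded zs :
  cvg ('[z k - zs, z k - zs] @[k --> \oo]) -> exists M, forall k, inorm (z k) <= M.
Proof.
move=> /cvg_seq_bounded/pinfty_ex_gt0[M M0 zM].
exists (Num.sqrt M + inorm zs) => k.
rewrite -{1}(subrK zs (z k)); apply: le_trans (ler_inormD _ _) _.
rewrite lerD2r ler_sqrt ?(ltW M0)//; apply: le_trans (zM k I).
exact: ler_norm.
Qed.

Lemma iteration_asymptotics zs : gap_summable -> sol zs ->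
  cvg ('[z k - zs, z k - zs] @[k --> \oo]) /\ bounded_sums K steps.
Proof.
move=> gs szs; have [phis psis] := sol_fin szs.
have [ps Nps Hps] := sol_multiplier szs.
have [b [b0 sb bgap]] := gs zs szs ps Nps.
apply: (iteration_fejer phis psis b0 sb) => k w Kk phiw psiw.
have := bgap k w phiw; rewrite /F (innerC (w - zs)).
have := Hps w psiw; rewrite /Hr => h1.
have : eps k * - '[ps, w - zs]
    <= eps k * (hh w + fine (psi w) - hh zs - fine (psi zs)).
  by rewrite ler_wpM2l ?(ltW (eps0 k))//; lra.
lra.
Qed.

(** Bounded iterates have bounded subgradients [g], which bound the values [h]:
    from above by the subgradient inequality at the iterate, from below by the
    multiplier. *)
Lemma bounds_and_rate zs : gap_summable -> sol zs ->
  exists M G : R, [/\ forall k, inorm (z k) <= M, forall k, inorm (g k) <= G &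
    k%:R * '[W k, W k] @[k --> \oo] --> (0 : R)].
Proof.
move=> gs szs; have [zcvg ss] := iteration_asymptotics gs szs.
have [phis psis] := sol_fin szs; have [ps Nps Hps] := sol_multiplier szs.
have [M zM] := iterates_bounded zcvg.
have M0 : 0 <= M by exact: le_trans (inorm_ge0 _) (zM 0%N).
have [G1 etaG] := eta_bounded zM.
pose G : R := `|Lh| * (M + inorm zs) + inorm (D zs) + G1.
have dM k : inorm (z k - zs) <= M + inorm zs.
  by apply: le_trans (ler_inormB _ _) _; rewrite lerD2r.
have gG k : inorm (g k) <= G.
  apply: le_trans (ler_inormD _ _) _; apply: lerD => //.
  rewrite -(subrK (D zs) (D _)); apply: le_trans (ler_inormD _ _) _.
  rewrite lerD2r; apply: le_trans (D_lip _ _) _.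
  apply: (@le_trans _ _ (`|Lh| * inorm (z k.+1 - zs))).
    by rewrite ler_wpM2r ?inorm_ge0// ler_norm.
  by rewrite ler_wpM2l.
have G0 : 0 <= G by exact: le_trans (inorm_ge0 _) (gG 0%N).
clearbody G.
exists M, G; split=> //.
apply: (@iteration_rate (G ^+ 2) (`|Hr zs| + (inorm ps + G) * (M + inorm zs))) => //.
  by move=> k; rewrite -sqr_inorm lerXn2r ?nnegrE ?inorm_ge0.
move=> k; have [phik psik] := z_fin k.
have h1 := Hps (z k.+1) psik.
have h2 : '[ps, z k.+1 - zs] <= inorm ps * (M + inorm zs).
  by apply: le_trans (cauchy_schwarz _ _) _; rewrite ler_wpM2l ?inorm_ge0.
have h3 : '[D (z k.+1), z k.+1 - zs] + '[eta k.+1, z k.+1 - zs]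
    <= G * (M + inorm zs).
  by rewrite -innerDl; apply: le_trans (cauchy_schwarz _ _) _;
    exact: ler_pM (inorm_ge0 _) (inorm_ge0 _) (gG k) (dM k.+1).
have h4 := hh_grad (z k.+1) zs.
have h5 := subdiff_ge (eta_in k) (esym (fineK psik)) (esym (fineK psis)).
have Mzs : 0 <= M + inorm zs by rewrite addr_ge0 ?inorm_ge0.
have h8 : 0 <= inorm ps * (M + inorm zs) by rewrite mulr_ge0 ?inorm_ge0.
have h9 : 0 <= G * (M + inorm zs) by rewrite mulr_ge0.
have /andP[h10 h11] : - `|Hr zs| <= Hr zs <= `|Hr zs| by rewrite -ler_norml.
rewrite (inner_opprB _ zs) in h4; rewrite (inner_opprB _ zs) in h5.
rewrite ler_norml mulrDl /h; rewrite /Hr in h1 h10 h11 *.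
by apply/andP; split; lra.
Qed.

Lemma residual_le (G : R) k : (forall k, inorm (g k) <= G) ->
  inorm (res k) <= inorm (W k) + eps k * G.
Proof.
move=> gG; have -> : res k = W k - eps k *: g k by rewrite /W addrK.
apply: le_trans (ler_inormB _ _) _; rewrite lerD2l inormZ gtr0_norm//.
by rewrite ler_wpM2l// ltW.
Qed.

(** Convexity bounds the penalised objective [F + eps k * H] at an iterate by
    the residual of the penalised problem there. *)
Lemma penalised_value_le zs k : sol zs ->
  F zs (z k.+1) + eps k * (h k - Hr zs) <= inorm (W k) * inorm (z k.+1 - zs).
Proof.
move=> szs; have [phis psis] := sol_fin szs; have [phik psik] := z_fin k.
apply: le_trans (cauchy_schwarz _ _).
have h1 := subdiff_ge (xi_in k) (esym (fineK phik)) (esym (fineK phis)).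
have h2 := subdiff_ge (eta_in k) (esym (fineK psik)) (esym (fineK psis)).
have h3 := hh_grad (z k.+1) zs.
have h4 : eps k * (h k - Hr zs) <= eps k * '[g k, z k.+1 - zs].
  rewrite ler_wpM2l ?(ltW (eps0 k))// /h /Hr /g innerDl.
  by move: h2 h3; rewrite !(inner_opprB _ zs); lra.
move: h1 h4; rewrite /F /W /g (innerC _ (B _)) (inner_opprB _ zs).
by rewrite !innerDl innerZl !innerDl; lra.
Qed.

Lemma value_excess_le zs k : sol zs ->
  eps k * (h k - Hr zs) <= inorm (W k) * inorm (z k.+1 - zs).
Proof.
move=> szs; have [phik psik] := z_fin k.
by have := penalised_value_le k szs; have := gap_ge0 szs.1 phik; lra.
Qed.

(** Convergence of the distances to optimal points and optimality of weak limits
    are the hypotheses of Opial's lemma; the multiplier then bounds the lower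
    limit of the values, since it is normal at [zs] and the weak limit is a
    zero. *)
Lemma weak_convergence zs : gap_summable -> sol zs ->
  (forall e, 0 < e -> \forall k \near \oo, h k <= Hr zs + e) ->
  h k @[k --> \oo] --> Hr zs /\ exists2 p, sol p & weak_cvg z p.
Proof.
move=> gs szs hle; have [M [G [zM gG Wrate]]] := bounds_and_rate gs szs.
have W0 : inorm (W k) @[k --> \oo] --> (0 : R).
  rewrite -sqrtr0; apply: (@cvg_comp _ _ _ (fun k => '[W k, W k]) Num.sqrt);
    last exact: sqrt_continuous.
  apply: (squeeze_cvgr _ (cvg_cst 0) Wrate); exists 1%N => // k /= k1.
  by rewrite inner_ge0/= ler_peMl ?inner_ge0// ler1n.
have res0 : inorm (res k) @[k --> \oo] --> (0 : R).
  apply: (@squeeze_cvgr _ _ _ _ (fun=> 0) (fun k => inorm (W k) + eps k * G)).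
  - by apply: nearW => k; rewrite inorm_ge0 residual_le.
  - exact: cvg_cst.
  - rewrite -[X in _ --> X](addr0 0); apply: cvgD => //.
    by rewrite -[X in _ --> X](mul0r G); exact: cvgMl.
have [p sp yp] : exists2 p, sol p & weak_cvg y p.
  apply: (opial (M := M) rV).
  - by apply: nearW => k; exact: zM.
  - move=> p sp; have [+ _] := iteration_asymptotics gs sp.
    move=> /cvg_ex[l zl]; apply/cvg_ex; exists l.
    by rewrite (cvg_shiftS (fun k => '[z k - p, z k - p])).
  - move=> U p UU oU yp; have PU := @ultra_proper _ _ UU.
    have Zp := weak_limit_zero PU oU yp (fun k => zM k.+1) res0.
    exact: weak_limit_sol PU oU yp szs Zp hle.
split; last first.
  by exists p => // w; rewrite -(cvg_shiftS (fun k => '[z k, w])); exact: yp.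
have [ps Nps Hps] := sol_multiplier szs.
apply/cvgrPdist_le => e e0.
have := yp ps => /cvgrPdist_le /(_ e e0) near_ps.
near=> k; rewrite distrC ler_norml; have [_ psik] := z_fin k.
have h1 : h k <= Hr zs + e by near: k; exact: hle.
have h2 : `|'[p, ps] - '[y k, ps]| <= e by near: k.
have h3 := Nps p sp.1.
have h4 : Hr zs - '[ps, y k - zs] <= h k := Hps _ psik.
move: h2 h3 h4; rewrite ler_norml !innerDr !innerNr (innerC p) (innerC (y k)).
by move=> /andP[h2 h2'] h3 h4; apply/andP; split; lra.
Unshelve. all: by end_near. Qed.

Lemma sharpness_gap_summable rho : 1 < rho -> sharpness B phi Kb rho ->
  bounded_sums K (fun k => eps k `^ (rho / (rho - 1))) -> gap_summable.
Proof.
move=> rho1 sh se zs szs ps Nps.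
have [C C0 gapC] := sharpness_gap rho1 sh szs Nps.
exists (fun k => C * eps k `^ (rho / (rho - 1))); split.
- by move=> k; rewrite mulr_ge0 ?powR_ge0.
- exact: (bounded_sums_le C0 _ se).
- by move=> k w; exact: gapC.
Qed.

(** Sharpness also bounds the value from below: applied with [2 * eps k] it
    leaves a full copy of the linear term, which dominates the deficit. *)
Lemma value_deficit_le rho zs : 1 < rho -> sharpness B phi Kb rho -> sol zs ->
  exists2 C : R, 0 <= C & forall k, eps k * (Hr zs - h k)
    <= inorm (W k) * inorm (z k.+1 - zs) + C * eps k `^ (rho / (rho - 1)).
Proof.
move=> rho1 sh szs; have [ps Nps Hps] := sol_multiplier szs.
have [C C0 gapC] := sharpness_gap rho1 sh szs Nps.
exists (C * 2 `^ (rho / (rho - 1))); first by rewrite mulr_ge0 ?powR_ge0.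
move=> k; have [phik psik] := z_fin k.
have := gapC _ _ (mulr_gt0 (ltr0n R 2) (eps0 k)) phik.
rewrite powRM ?(ltW (eps0 k))// mulrA.
have := penalised_value_le k szs.
have h1 : Hr zs - '[ps, z k.+1 - zs] <= h k := Hps _ psik.
have h2 : eps k * (Hr zs - h k) <= eps k * '[ps, z k.+1 - zs].
  by rewrite ler_wpM2l ?(ltW (eps0 k))//; lra.
lra.
Qed.

(** Everything that the rates use: [w k] bounds the residual of the penalised
    problem and tends to zero faster than [k `^ (- 1 / 2)] whatever the decay of
    [eps]. *)
Lemma bilevel_rates zs :
  attouch_czarnecki B phi Kb eps \/ (exists rho, [/\ 1 < rho,
    sharpness B phi Kb rho & bounded_sums K (fun k => eps k `^ (rho / (rho - 1)))]) ->
  sol zs -> exists (M : R) (w : nat -> R), [/\ 0 <= M,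
    [/\ forall k, inorm (z k.+1 - zs) <= M, forall k, 0 <= w k,
        k%:R * w k ^+ 2 @[k --> \oo] --> (0 : R),
        forall k, inorm (res k) <= w k + M * eps k &
        forall k, eps k * (h k - Hr zs) <= M * w k],
    (forall rho, 1 < rho -> sharpness B phi Kb rho -> exists2 C : R, 0 <= C &
      forall k, eps k * (Hr zs - h k) <= M * w k + C * eps k `^ (rho / (rho - 1))) &
    ((forall e, 0 < e -> \forall k \near \oo, h k <= Hr zs + e) ->
      h k @[k --> \oo] --> Hr zs /\ exists2 p, sol p & weak_cvg z p)].
Proof.
move=> gc szs; have gs : gap_summable.
  case: gc => [|[rho [rho1 sh se]]]; first exact: attouch_czarnecki_gap.
  exact: sharpness_gap_summable se.
have [M [G [zM gG Wrate]]] := bounds_and_rate gs szs.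
have M0 : 0 <= M by exact: le_trans (inorm_ge0 _) (zM 0%N).
have G0 : 0 <= G by exact: le_trans (inorm_ge0 _) (gG 0%N).
have N0 := inorm_ge0 zs.
have dM k : inorm (z k.+1 - zs) <= M + inorm zs + G.
  apply: le_trans (ler_inormB _ _) _; have := zM k.+1; lra.
have Mw k : inorm (W k) * inorm (z k.+1 - zs)
    <= (M + inorm zs + G) * inorm (W k).
  by rewrite mulrC ler_wpM2r ?inorm_ge0.
exists (M + inorm zs + G), (fun k => inorm (W k)); split.
- by rewrite !addr_ge0.
- split=> //.
  + by move=> k; exact: inorm_ge0.
  + by under eq_fun do rewrite sqr_inorm.
  + move=> k; apply: le_trans (residual_le _ gG) _; rewrite lerD2l mulrC.
    by rewrite ler_wpM2r ?(ltW (eps0 k))//; lra.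
  + by move=> k; apply: le_trans (value_excess_le _ szs) (Mw k).
- move=> rho rho1 sh; have [C C0 hC] := value_deficit_le rho1 sh szs.
  by exists C => // k; apply: le_trans (hC k) _; rewrite lerD2r.
- exact: weak_convergence.
Qed.
End iteration.

(** * The regularisation parameters *)

Section parameters.
Context {R : realType}.
Implicit Types (p r t : R) (k n : nat).

Lemma powR_opp_gt0 k r : 0 < (k.+1%:R `^ r)^-1 :> R.
Proof. by rewrite invr_gt0 powR_gt0. Qed.

Lemma powR_cvg0_infty r : 0 < r -> (k.+1%:R `^ r)^-1 @[k --> \oo] --> (0 : R).
Proof.
move=> r0; apply/cvgrPdist_le => e e0; near=> k.
rewrite sub0r normrN gtr0_norm ?powR_opp_gt0// -(invrK e).
have e'0 : 0 < e^-1 by rewrite invr_gt0.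
rewrite lef_pV2 ?posrE ?powR_gt0//.
have -> : e^-1 = (e^-1 `^ r^-1) `^ r.
  by rewrite -powRrM mulVf ?gt_eqF// powRr1// ltW.
rewrite ge0_ler_powR ?nnegrE ?powR_ge0 ?(ltW r0)//.
have : e^-1 `^ r^-1 <= k%:R by near: k; exact: nbhs_infty_ger.
by move=> /le_trans; apply; rewrite ler_nat.
Unshelve. all: by end_near. Qed.

(** Comparison with the telescoping series of [k `^ (1 - p)], whose terms are
    bounded below through [ln (1 + x) <= x] and [1 + x <= expR x]. *)
Lemma bounded_sums_powR K p : (0 < K)%N -> 1 < p ->
  bounded_sums K (fun k => (k.+1%:R `^ p)^-1 : R).
Proof.
move=> K0 p1; pose r := p - 1; have r0 : 0 < r by rewrite subr_gt0.
(* At [0] the inverse of [0 `^ r = 0] is [0]; the sums start at [K >= 1]. *)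
pose f k : R := (k%:R `^ r)^-1.
apply: (@bounded_sums_le _ _ _ (fun k => f k - f k.+1) r^-1).
- by rewrite invr_ge0 ltW.
- move=> k /(leq_trans K0) k1; have k0 : 0 < k%:R :> R by rewrite ltr0n.
  have k10 : 0 < k.+1%:R :> R by [].
  pose y : R := 1 - k.+1%:R^-1.
  have y0 : 0 < y by rewrite subr_gt0 invf_lt1// ltr1n.
  have kE : k%:R = k.+1%:R * y :> R.
    by rewrite /y mulrBr mulr1 mulfV ?gt_eqF// -natr1 addrK.
  have pE : (k.+1%:R `^ p)^-1 = f k.+1 * k.+1%:R^-1 :> R.
    rewrite /f -invfM -[X in _ = (_ * X)^-1](powRr1 (ltW k10)) -powRD.
      by congr (_ `^ _)^-1; rewrite /r subrK.
    by rewrite (gt_eqF k10) implybT.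
  have fk : f k = f k.+1 * y `^ (- r).
    by rewrite /f -!powRN kE powRM// ltW.
  have ln_le : ln y <= - k.+1%:R^-1.
    by rewrite /y le_ln1Dx// ltrN2 invf_lt1// ltr1n.
  have le_y : 1 + r * k.+1%:R^-1 <= y `^ (- r).
    rewrite /powR gt_eqF//; apply: le_trans (expR_ge1Dx _).
    by rewrite lerD2l mulNr -mulrN ler_wpM2l ?(ltW r0)// lerNr.
  rewrite pE fk ler_pdivlMl//.
  have f0 : 0 <= f k.+1 by exact/ltW/powR_opp_gt0.
  have := ler_wpM2l f0 le_y.
  by move: (f k.+1) (y `^ _) k.+1%:R^-1 => f1 y' t; lra.
- by apply: bounded_sums_telescope => k; rewrite invr_ge0 powR_ge0.
Qed.

Context (c a delta : R).
Context (c0 : 0 < c) (a0 : 0 < a) (delta0 : 0 < delta).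

Let eps k : R := c / (k%:R + a) `^ delta.

Let ka0 k : 0 < k%:R + a. Proof. by rewrite ltr_wpDl. Qed.

Lemma param_gt0 k : 0 < eps k.
Proof. by rewrite divr_gt0// powR_gt0. Qed.

Lemma param_dec k : eps k.+1 <= eps k.
Proof.
rewrite /eps ler_wpM2l ?(ltW c0)// lef_pV2 ?posrE ?powR_gt0//.
by rewrite ge0_ler_powR ?nnegrE ?(ltW delta0) ?(ltW (ka0 _))// lerD2r ler_nat.
Qed.

(** Convexity of [t |-> t `^ (- delta)] at three consecutive points: the
    arithmetic mean dominates the geometric one, and [(t - 1) * (t + 1) <= t ^ 2]. *)
Lemma param_convex k : eps k.+1 - eps k.+2 <= eps k - eps k.+1.
Proof.
pose u := k%:R + a; pose w := k.+2%:R + a; pose v := k.+1%:R + a.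
pose m t := t `^ (- (delta / 2)).
have mE t : 0 < t -> (t `^ delta)^-1 = m t ^+ 2.
  move=> t0; rewrite /m expr2 -powRD; last by rewrite (gt_eqF t0) implybT.
  by rewrite -opprD -splitr powRN.
have m0 t : 0 < t -> 0 < m t by exact: powR_gt0.
have [u0 v0 w0] : [/\ 0 < u, 0 < v & 0 < w] by split; exact: ka0.
have muw : m v ^+ 2 <= m u * m w.
  rewrite -(mE v)// /m -powRM ?(ltW u0) ?(ltW w0)//.
  have -> : (v `^ delta)^-1 = (v * v) `^ (- (delta / 2)).
    rewrite powRM ?(ltW v0)// -powRD; last by rewrite (gt_eqF (ka0 _)) implybT.
    by rewrite -opprD -splitr powRN.
  rewrite !powRN lef_pV2 ?posrE ?powR_gt0 ?mulr_gt0//.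
  rewrite ge0_ler_powR ?nnegrE ?mulr_ge0 ?(ltW u0) ?(ltW v0) ?(ltW w0)
    ?divr_ge0 ?(ltW delta0)//.
  have -> : w = u + 2 by rewrite /w /u -addn2 natrD; lra.
  have -> : v = u + 1 by rewrite /v /u -addn1 natrD; lra.
  lra.
rewrite /eps -/u -/v -/w (mE u)// (mE v)// (mE w)//.
have : 2 * m v ^+ 2 <= m u ^+ 2 + m w ^+ 2.
  by have := sqr_ge0 (m u - m w); lra.
by move=> /(ler_wpM2l (ltW c0)); lra.
Qed.

Lemma param_le : exists2 C : R, 0 < C & forall k, eps k <= C * (k.+1%:R `^ delta)^-1.
Proof.
pose m := Num.min 1 a; have m0 : 0 < m by rewrite lt_min ltr01.
exists (c / m `^ delta) => [|k]; first by rewrite divr_gt0 ?powR_gt0.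
rewrite /eps -mulrA ler_wpM2l ?(ltW c0)// -invfM -powRM ?(ltW m0)//.
rewrite lef_pV2 ?posrE ?powR_gt0 ?mulr_gt0//.
rewrite ge0_ler_powR ?nnegrE ?mulr_ge0 ?(ltW m0) ?(ltW delta0) ?(ltW (ka0 _))//.
have : m <= 1 by rewrite ge_min lexx.
have : m <= a by rewrite ge_min lexx orbT.
move=> ma m1; rewrite -natr1 mulrDr mulr1 lerD//.
by rewrite ler_piMl.
Qed.

Lemma param_ge : exists2 C : R, 0 < C & forall k, C * (k.+1%:R `^ delta)^-1 <= eps k.
Proof.
exists (c / (1 + a) `^ delta) => [|k].
  by rewrite divr_gt0 ?powR_gt0// addr_gt0.
have a1 : 0 < 1 + a by rewrite addr_gt0.
rewrite /eps -mulrA ler_wpM2l ?(ltW c0)// -invfM -powRM ?(ltW a1)//.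
rewrite lef_pV2 ?posrE ?powR_gt0 ?mulr_gt0//.
rewrite ge0_ler_powR ?nnegrE ?mulr_ge0 ?(ltW a1) ?(ltW delta0) ?(ltW (ka0 _))//.
have := mulr_ge0 (ler0n R k) (ltW a0).
by rewrite -natr1; lra.
Qed.

Lemma param_cvg0 : eps k @[k --> \oo] --> (0 : R).
Proof.
have [C C0 epsC] := param_le.
apply: (@squeeze_cvgr _ _ _ _ (fun=> 0) (fun k => C * (k.+1%:R `^ delta)^-1)).
- by apply: nearW => k; rewrite (ltW (param_gt0 k))/=.
- exact: cvg_cst.
- by rewrite -[X in _ --> X](mulr0 C); apply: cvgMr; exact: powR_cvg0_infty.
Qed.

Lemma bounded_sums_param K p : (0 < K)%N -> 1 < delta * p ->
  bounded_sums K (fun k => eps k `^ p).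
Proof.
move=> K0 dp; have [C C0 epsC] := param_le.
have p0 : 0 < p by rewrite -(pmulr_rgt0 _ delta0) (lt_trans ltr01).
apply: (bounded_sums_le (C := C `^ p) _ _ (bounded_sums_powR K0 dp)).
  exact: powR_ge0.
move=> k _; apply: (@le_trans _ _ ((C * (k.+1%:R `^ delta)^-1) `^ p)).
  rewrite ge0_ler_powR ?nnegrE ?(ltW p0) ?(ltW (param_gt0 _))//.
  by rewrite mulr_ge0 ?(ltW C0)// ltW ?powR_opp_gt0.
rewrite powRM ?(ltW C0) ?(ltW (powR_opp_gt0 _ _))// powRrM.
by rewrite -!powRN -!powRrM !mulNr mulrN.
Qed.

End parameters.

(** * The primal-dual operator *)

Lemma inner_ext {R : realType} {V : innerType R} (u v : V) :
  (forall w, '[u, w] = '[v, w]) -> u = v.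
Proof.
move=> uv; apply/eqP; rewrite -subr_eq0; apply/eqP/inner_eq0.
by rewrite innerDl innerNl uv subrr.
Qed.

Section product_norm.
Context {R : realType} {H G : hilbertType R}.

Lemma inorm_fst (u : H * G) : `|u.1| <= inorm u.
Proof.
rewrite -(@ler_pXn2r _ 2) ?nnegrE ?inorm_ge0// sqr_inorm prod_innerE.
by rewrite inner_norm lerDl inner_ge0.
Qed.

Lemma inorm_snd (u : H * G) : `|u.2| <= inorm u.
Proof.
rewrite -(@ler_pXn2r _ 2) ?nnegrE ?inorm_ge0// sqr_inorm prod_innerE.
by rewrite (inner_norm u.2) lerDr inner_ge0.
Qed.

Lemma inorm_inl (x : H) : inorm (x, 0 : G) = `|x|.
Proof. by rewrite /inorm prod_innerE /= inner0l addr0 -inorm_norm. Qed.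

End product_norm.

Section bounded_operator.
Context {R : realType} {H G : hilbertType R} (A : {linear H -> G}) (As : G -> H).
Context (A_cont : continuous A) (A_adj : is_adjoint A As).

Lemma opnorm_le x : `|A x| <= opnorm A * `|x|.
Proof.
have /linear_boundedP : bounded_near A (nbhs (0 : H)).
  by apply: continuous_linear_bounded; exact: A_cont.
move=> /pinfty_ex_gt0[C C0 AC].
have Sub : ubound [set `|A x| | x in [set x : H | `|x| <= 1]] C.
  move=> _ [y /= y1 <-]; apply: le_trans (AC y) _.
  by rewrite ler_piMr// ltW.
have [->|x0] := eqVneq x 0; first by rewrite linear0 !normr0 mulr0.
have nx : 0 < `|x| by rewrite normr_gt0.
rewrite -ler_pdivrMr// mulrC -[X in X * _]gtr0_norm ?invr_gt0// -normrZ -linearZ.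
apply: ub_le_sup; first by exists C.
by exists (`|x|^-1 *: x) => //=; rewrite normrZ gtr0_norm ?invr_gt0// mulVf ?gt_eqF.
Qed.

Lemma opnorm_ge0 : 0 <= opnorm A.
Proof.
have /linear_boundedP : bounded_near A (nbhs (0 : H)).
  by apply: continuous_linear_bounded; exact: A_cont.
move=> /pinfty_ex_gt0[C C0 AC].
apply: ub_le_sup; last by exists 0; rewrite /= ?normr0// linear0 normr0.
exists C => _ [y /= y1 <-]; apply: le_trans (AC y) _.
by rewrite ler_piMr// ltW.
Qed.

Lemma adjoint_add u v : As (u + v) = As u + As v.
Proof.
apply: inner_ext => w; rewrite innerDl !(innerC _ w) -!A_adj innerDr.
by [].
Qed.

Lemma adjoint_opp u : As (- u) = - As u.
Proof. by apply: inner_ext => w; rewrite innerNl !(innerC _ w) -!A_adj innerNr. Qed.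

(** [|As u|^2 = <A (As u), u>]. *)
Lemma adjoint_le u : `|As u| <= opnorm A * `|u|.
Proof.
have [->|u0] := eqVneq (As u) 0.
  by rewrite normr0 mulr_ge0 ?opnorm_ge0.
rewrite -(@ler_pM2l _ `|As u|) ?normr_gt0// -expr2 -inner_norm -A_adj.
apply: le_trans (inner_le_norm _ _) _.
by rewrite mulrA ler_wpM2r// mulrC opnorm_le.
Qed.

(** The Lipschitz operator [(dm x + As l, - A x)] is a gradient plus a
    skew-symmetric operator. *)
Section operator.
Context (dm : H -> H) (Lm : R).
Context (dm_mono : forall x y, 0 <= '[dm x - dm y, x - y]).
Context (Lm0 : 0 <= Lm) (dm_lip : forall x y, `|dm x - dm y| <= Lm * `|x - y|).

Let B (z : H * G) : H * G := (dm z.1 + As z.2, - A z.1).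

Lemma pd_operatorB u v : B u - B v = (dm u.1 - dm v.1, 0)
  + (As (u.2 - v.2), - A (u.1 - v.1)) :> H * G.
Proof.
apply/pair_equal_spec; split => /=.
  by rewrite adjoint_add adjoint_opp opprD addrACA.
by rewrite add0r linearB opprB opprK addrC.
Qed.

Lemma pd_operator_mono u v : 0 <= '[B u - B v, u - v].
Proof.
rewrite pd_operatorB innerDl !prod_innerE /= inner0l addr0.
rewrite innerNl A_adj (innerC (As _)) subrr addr0.
exact: dm_mono.
Qed.

Lemma pd_operator_lip u v : inorm (B u - B v) <= (Lm + opnorm A) * inorm (u - v).
Proof.
rewrite pd_operatorB mulrDl; apply: le_trans (ler_inormD _ _) _; apply: lerD.
  rewrite inorm_inl; apply: le_trans (dm_lip _ _) _.
  by rewrite ler_wpM2l// (inorm_fst (u - v)).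
rewrite -(@ler_pXn2r _ 2) ?nnegrE ?mulr_ge0 ?inorm_ge0 ?opnorm_ge0//.
rewrite exprMn !sqr_inorm !prod_innerE /= !inner_norm normrN mulrDr addrC.
rewrite -!exprMn; apply: lerD; rewrite lerXn2r ?nnegrE ?mulr_ge0 ?opnorm_ge0//.
  exact: opnorm_le.
exact: adjoint_le.
Qed.

End operator.
End bounded_operator.

Section subdifferentials.
Context {R : realType}.

(** The proximal map of [s * phi] produces a subgradient of [phi]. Finiteness of
    [phi] at the minimiser needs a point of the domain, because in the zero
    space the strict inequality of the definition is void. *)
Lemma is_prox_subdiff {H : hilbertType R} (phi : H -> \bar R) (s : R) (x u w0 : H) :
  0 < s -> (forall w, phi w != -oo%E) -> econvex phi -> phi w0 \is a fin_num ->
  is_prox (fun w => s%:E * phi w)%E x u -> subdiff phi u (s^-1 *: (x - u)).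
Proof.
move=> s0 phiN cphi w0fin prox.
have sphi w a : phi w = a%:E -> (s%:E * phi w)%E = (s * a)%:E by move=> ->.
have phiu : phi u \is a fin_num.
  have [uE|[a ->]//] := ereal_cases (phiN u).
  have [w0u|/prox] := eqVneq w0 u; first by rewrite -w0u.
  by rewrite uE gt0_muley ?lte_fin// (sphi _ _ (esym (fineK w0fin))) addye.
apply: prox_subdiff => // w.
have [->//|wu] := eqVneq w u.
have [->|[b bE]] := ereal_cases (phiN w); first by rewrite addye// leey.
have := prox w wu; rewrite (sphi _ _ (esym (fineK phiu))) (sphi _ _ bE).
rewrite -(fineK phiu) bE -!EFinD lte_fin lee_fin -!inner_norm => lt.
rewrite -(ler_pM2l s0) !mulrDr.
have sV t : s * (s^-1 / 2 * t) = 2^-1 * t by field; rewrite gt_eqF.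
by rewrite !sV ltW.
Qed.

Lemma adde_def_gtNy (a b : \bar R) : a != -oo%E -> b != -oo%E -> (a +? b)%E.
Proof. by case: a b => [a| |] [b| |]. Qed.

Lemma mule_gtNy (t : R) (a : \bar R) : 0 <= t -> a != -oo%E -> (t%:E * a)%E != -oo%E.
Proof.
case: a => [a| |]// t0 _; have [->|t0'] := eqVneq t 0; first by rewrite mul0e.
by rewrite gt0_muley// lte_fin lt_def t0'.
Qed.

Lemma econvexD {V : innerType R} (phi psi : V -> \bar R) (e : R) : 0 < e ->
  (forall w, phi w != -oo%E) -> (forall w, psi w != -oo%E) ->
  econvex phi -> econvex psi -> econvex (fun w => phi w + e%:E * psi w)%E.
Proof.
move=> e0 phiN psiN cphi cpsi x y t t01; have /andP[t0 t1] := t01.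
have h1 := cphi x y t t01.
have h2 := lee_wpmul2l (_ : 0 <= e%:E)%E (cpsi x y t t01).
have {h2}h := leeD h1 (h2 (ltW e0)); apply: le_trans h _.
rewrite !muleDr ?adde_def_gtNy ?mule_gtNy ?subr_ge0 ?(ltW e0)//.
by rewrite muleCA (muleCA e%:E) addeACA.
Qed.

Section product.
Context {V W : innerType R}.
Implicit Types (phi : V -> \bar R) (psi : W -> \bar R).

Lemma subdiff_prod phi psi x y p q :
  subdiff phi x p -> subdiff psi y q ->
  subdiff (fun z : V * W => phi z.1 + psi z.2)%E (x, y) (p, q).
Proof.
move=> [phix subp] [psiy subq]; split=> [|[u v]] /=.
  by rewrite fin_numD phix.
by rewrite prod_innerE /= EFinD addeACA leeD.
Qed.

Lemma subdiff_prod_inv phi psi x y p q :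
  (forall u, phi u != -oo%E) -> (forall v, psi v != -oo%E) ->
  subdiff (fun z : V * W => phi z.1 + psi z.2)%E (x, y) (p, q) ->
  subdiff phi x p /\ subdiff psi y q.
Proof.
move=> phiN psiN [/= fin sub].
have [phix psiy] : phi x \is a fin_num /\ psi y \is a fin_num.
  by move: fin; rewrite fin_numD => /andP.
split; split=> // w.
- have := sub (w, y); rewrite prod_innerE /= subrr inner0r addr0.
  by rewrite addeAC leeD2rE.
- have := sub (x, w); rewrite prod_innerE /= subrr inner0r add0r.
  by rewrite -addeA leeD2lE.
Qed.

Lemma econvex_prod phi psi : (forall u, phi u != -oo%E) -> (forall v, psi v != -oo%E) ->
  econvex phi -> econvex psi -> econvex (fun z : V * W => phi z.1 + psi z.2)%E.
Proof.
move=> phiN psiN cphi cpsi [x y] [x' y'] t t01 /=.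
apply: le_trans (leeD (cphi x x' t t01) (cpsi y y' t t01)) _.
by rewrite !muleDr ?adde_def_gtNy// addeACA.
Qed.

Lemma sup_affine_prod phi psi :
  (forall u, phi u != -oo%E) -> (forall v, psi v != -oo%E) ->
  sup_affine phi -> sup_affine psi -> sup_affine (fun z : V * W => phi z.1 + psi z.2)%E.
Proof.
move=> phiN psiN sphi spsi [x y] c /= cxy.
have [c1 [c2 [cE c1x c2y]]] : exists c1 c2 : R,
    [/\ c = c1 + c2, (c1%:E < phi x)%E & (c2%:E < psi y)%E].
  move: cxy; have [->|[a ->]] := ereal_cases (phiN x);
    have [->|[b ->]] := ereal_cases (psiN y).
  - by exists c, 0; rewrite addr0 !ltry.
  - by exists (c - (b - 1)), (b - 1); rewrite subrK ltry lte_fin; split=> //; lra.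
  - by exists (a - 1), (c - (a - 1)); rewrite addrC subrK ltry lte_fin; split=> //; lra.
  - rewrite -EFinD lte_fin => cab; exists (a - (a + b - c) / 2), (b - (a + b - c) / 2).
    by rewrite !lte_fin; split; lra.
have [p [al [pmin pc]]] := sphi x c1 c1x; have [q [be [qmin qc]]] := spsi y c2 c2y.
exists (p, q), (al + be); split=> [[u v]|]; rewrite prod_innerE /=.
  by rewrite addrACA EFinD leeD.
by rewrite cE addrACA ltrD.
Qed.

Lemma sup_affine_fst phi : sup_affine phi ->
  sup_affine (fun z : V * W => phi z.1).
Proof.
move=> sphi [x y] c /sphi[p [al [pmin pc]]]; exists (p, 0), al.
by split=> [[u v]|]; rewrite prod_innerE /= inner0l addr0.
Qed.

End product.
End subdifferentials.

(** * Asymptotics *)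

Section asymptotics.
Context {R : realType}.
Implicit Types (u v : nat -> R^o) (w : nat -> R).

Lemma littleo_shift u v : (forall e : R, 0 < e ->
    \forall k \near \oo, `|u k.+1| <= e * `|v k.+1|) -> u =o_\oo v.
Proof.
move=> uv; apply/eqoP => e e0; apply: near_inftyS; exact: uv.
Qed.

Lemma bigO_shift u v (C : R) :
  (\forall k \near \oo, `|u k.+1| <= C * `|v k.+1|) -> u =O_\oo v.
Proof.
move=> uv; apply/eqO_exP; exists (`|C| + 1); first by rewrite ltr_wpDl.
apply: near_inftyS; apply: filterS uv => k /le_trans; apply.
by rewrite ler_wpM2r// (le_trans (ler_norm C))// lerDl.
Qed.

Lemma inv_sqrtE : (fun k => (Num.sqrt k%:R)^-1 : R^o) = (fun k => (k%:R `^ 2^-1)^-1).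
Proof. by apply/funext => k; rewrite powR12_sqrt. Qed.

Lemma inv_powR_norm (p : R) k : `|(k%:R `^ p)^-1| = (k%:R `^ p)^-1 :> R.
Proof. by rewrite ger0_norm// invr_ge0 powR_ge0. Qed.

Lemma powR_split (p r : R) k :
  (k.+1%:R `^ (p + r))^-1 = (k.+1%:R `^ p)^-1 * (k.+1%:R `^ r)^-1 :> R.
Proof.
by rewrite -invfM powRD// (gt_eqF (ltr0Sn R k)) implybT.
Qed.

Lemma inv_powR_le (p r : R) k : p <= r ->
  (k.+1%:R `^ r)^-1 <= (k.+1%:R `^ p)^-1 :> R.
Proof.
move=> pr; rewrite lef_pV2 ?posrE ?powR_gt0//.
by rewrite ler_powR// ler1n.
Qed.

(* The shift from [k] to [k.+1] costs the factor 2 in the choice of the bound. *)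
Lemma small_rate w (p e : R) : p <= 2^-1 -> 0 < e -> (forall k, 0 <= w k) ->
  k%:R * w k ^+ 2 @[k --> \oo] --> (0 : R) ->
  \forall k \near \oo, w k <= e * (k.+1%:R `^ p)^-1.
Proof.
move=> p2 e0 w0 kw.
have e2 : 0 < e ^+ 2 / 2 by rewrite divr_gt0// exprn_gt0.
move/cvgrPdist_le : kw => /(_ _ e2) kw.
near=> k; apply: (@le_trans _ _ (e * (k.+1%:R `^ 2^-1)^-1)); last first.
  by rewrite ler_wpM2l ?(ltW e0)// inv_powR_le.
have k1 : (1 <= k)%N by near: k; exists 1%N.
rewrite -(@ler_pXn2r _ 2) ?nnegrE ?mulr_ge0 ?invr_ge0 ?powR_ge0 ?(ltW e0)//.
rewrite exprMn exprVn powR12_sqrt// sqr_sqrtr// ler_pdivlMr//.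
have : `|0 - k%:R * w k ^+ 2| <= e ^+ 2 / 2 by near: k.
rewrite sub0r normrN ger0_norm ?mulr_ge0 ?sqr_ge0//.
have : w k ^+ 2 * k.+1%:R <= 2 * (k%:R * w k ^+ 2).
  rewrite mulrC mulrA ler_wpM2r ?sqr_ge0//.
  by rewrite -natrM ler_nat mul2n -addnn -addn1 leq_add2l.
move: (k%:R * _) (_ * k.+1%:R) => t t'; lra.
Unshelve. all: by end_near. Qed.

Lemma inv_powR_small (p e : R) : 0 < p -> 0 < e ->
  \forall k \near \oo, (k.+1%:R `^ p)^-1 <= e.
Proof.
move=> p0 e0; have /cvgrPdist_le/(_ e e0) := powR_cvg0_infty p0.
apply: filterS => k; rewrite sub0r normrN gtr0_norm ?powR_opp_gt0//.
Qed.

Context (c a delta : R) (c0 : 0 < c) (a0 : 0 < a) (delta0 : 0 < delta).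
Let eps k : R := c / (k%:R + a) `^ delta.
Lemma value_excess_small w (M e : R) (v : nat -> R) : (forall k, 0 <= w k) ->
  k%:R * w k ^+ 2 @[k --> \oo] --> (0 : R) -> 0 <= M -> 0 < e ->
  (forall k, eps k * v k <= M * w k) ->
  \forall k \near \oo, v k <= e * (k.+1%:R `^ (2^-1 - delta))^-1.
Proof.
move=> w0 kw M0 e0 vw; have [D D0 epsD] := param_ge c0 a0 delta0.
have e1 : 0 < e * D / (M + 1) by rewrite divr_gt0 ?mulr_gt0// ltr_wpDl.
near=> k.
have h1 : w k <= e * D / (M + 1) * (k.+1%:R `^ 2^-1)^-1.
  by near: k; exact: small_rate.
rewrite -(ler_pM2l (@param_gt0 _ c a delta c0 a0 k)) -/(eps k).
apply: le_trans (vw k) _.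
apply: (@le_trans _ _ (D * (k.+1%:R `^ delta)^-1
    * (e * (k.+1%:R `^ (2^-1 - delta))^-1))); last first.
  by rewrite ler_wpM2r// mulr_ge0 ?(ltW e0)// ltW// powR_opp_gt0.
rewrite mulrACA -powR_split addrC subrK.
apply: (@le_trans _ _ ((M + 1) * w k)); first by rewrite ler_wpM2r ?lerDl.
rewrite -ler_pdivlMl ?ltr_wpDl//; apply: le_trans h1 _.
rewrite le_eqVlt; apply/orP; left; apply/eqP; field.
by rewrite !gt_eqF ?ltr_wpDl ?powR_gt0.
Unshelve. all: by end_near. Qed.

Context (w : nat -> R) (w0 : forall k, 0 <= w k).
Context (kw : k%:R * w k ^+ 2 @[k --> \oo] --> (0 : R)).

(* [t] stands for the residual of the unperturbed problem. *)
Lemma residual_littleo (M C : R) (t : nat -> R) u : 0 <= M -> 0 <= C ->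
  2^-1 < delta ->
  (forall k, t k <= w k + M * eps k) -> (forall k, `|u k.+1| <= C * t k) ->
  u =o_\oo (fun k => (k%:R `^ 2^-1)^-1 : R^o).
Proof.
move=> M0 C0 d2 tw ut; apply: littleo_shift => e e0.
have [D D0 epsD] := param_le c0 a0 delta0.
have e1 : 0 < e / (2 * (C + 1)) by rewrite divr_gt0// mulr_gt0// ltr_wpDl.
have e2 : 0 < e / (2 * ((C + 1) * (M * D + 1))).
  by rewrite divr_gt0// !mulr_gt0// ltr_wpDl// mulr_ge0// ltW.
have dd : 0 < delta - 2^-1 by rewrite subr_gt0.
near=> k; rewrite inv_powR_norm; apply: le_trans (ut k) _.
have h1 : w k <= e / (2 * (C + 1)) * (k.+1%:R `^ 2^-1)^-1.
  by near: k; exact: small_rate.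
have h2 : (k.+1%:R `^ (delta - 2^-1))^-1 <= e / (2 * ((C + 1) * (M * D + 1))).
  by near: k; exact: inv_powR_small.
set v := (k.+1%:R `^ 2^-1)^-1 in h1 *.
have v0 : 0 <= v by rewrite invr_ge0 powR_ge0.
have h3 : M * eps k <= e / (2 * (C + 1)) * v.
  apply: (@le_trans _ _ (M * (D * (k.+1%:R `^ delta)^-1))).
    by rewrite ler_wpM2l// epsD.
  rewrite -[in X in X <= _](subrK 2^-1 delta) powR_split -/v.
  rewrite !mulrA ler_wpM2r//; apply: le_trans (ler_wpM2l _ h2) _.
    by rewrite mulr_ge0// ltW.
  rewrite ler_pdivlMr; last by rewrite mulr_gt0// ltr_wpDl.
  have MD : 0 < M * D + 1 by rewrite ltr_wpDl// mulr_ge0// ltW.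
  have -> : M * D * (e / (2 * ((C + 1) * (M * D + 1)))) * (2 * (C + 1))
      = e * (M * D / (M * D + 1)).
    by field; rewrite !gt_eqF// ltr_wpDl.
  by rewrite ler_piMr ?(ltW e0)// ler_pdivrMr// mul1r lerDl.
apply: (@le_trans _ _ ((C + 1) * (2 * (e / (2 * (C + 1)) * v)))).
  apply: (@le_trans _ _ (C * (2 * (e / (2 * (C + 1)) * v)))).
    by rewrite ler_wpM2l//; have := tw k; lra.
  by rewrite ler_wpM2r ?lerDl// mulr_ge0// mulr_ge0// ltW.
by rewrite le_eqVlt; apply/orP; left; apply/eqP; field; rewrite gt_eqF// ltr_wpDl.
Unshelve. all: by end_near. Qed.

Lemma residual_bigO (M C : R) (t : nat -> R) u : 0 <= M -> 0 <= C ->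
  delta <= 2^-1 ->
  (forall k, t k <= w k + M * eps k) -> (forall k, `|u k.+1| <= C * t k) ->
  u =O_\oo (fun k => (k%:R `^ delta)^-1 : R^o).
Proof.
move=> M0 C0 d2 tw ut; have [D D0 epsD] := param_le c0 a0 delta0.
apply: (@bigO_shift _ _ (C * (1 + M * D))).
near=> k; rewrite inv_powR_norm; apply: le_trans (ut k) _.
rewrite -mulrA ler_wpM2l//; apply: le_trans (tw k) _; rewrite mulrDl; apply: lerD.
  by near: k; exact: small_rate.
by rewrite -mulrA ler_wpM2l// epsD.
Unshelve. all: by end_near. Qed.

(** The extra term is absorbed in [w], as [eps k `^ p] is square summable with
    room to spare. *)
Lemma value_deficit_small (M C e p : R) (v : nat -> R) : 0 <= M -> 0 <= C ->
  0 < e -> 1 < delta * p ->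
  (forall k, eps k * v k <= M * w k + C * eps k `^ p) ->
  \forall k \near \oo, v k <= e * (k.+1%:R `^ (2^-1 - delta))^-1.
Proof.
move=> M0 C0 e0 dp vw; have [D D0 epsD] := param_le c0 a0 delta0.
have p0 : 0 < p by rewrite -(pmulr_rgt0 _ delta0) (lt_trans ltr01).
pose w' k := M * w k + C * eps k `^ p.
apply: (@value_excess_small w' 1) => //.
- by move=> k; rewrite addr_ge0// mulr_ge0 ?powR_ge0.
- have dp0 : 0 < delta * p * 2 - 1 by lra.
  apply: (@squeeze_cvgr _ _ _ _ (fun=> 0) (fun k => 2 * M ^+ 2 * (k%:R * w k ^+ 2)
    + 2 * (C * D `^ p) ^+ 2 * (k.+1%:R `^ (delta * p * 2 - 1))^-1)).
  + apply: nearW => k; rewrite mulr_ge0 ?sqr_ge0//=.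
    apply: (@le_trans _ _ (k%:R * (2 * (M * w k) ^+ 2 + 2 * (C * eps k `^ p) ^+ 2))).
      rewrite ler_wpM2l// /w'; move: (M * w k) (C * _) => x y.
      by have := sqr_ge0 (x - y); lra.
    rewrite mulrDr; apply: lerD; first by rewrite exprMn; lra.
    rewrite [leLHS](_ : _ = 2 * C ^+ 2 * (k%:R * (eps k `^ p) ^+ 2)); last by ring.
    rewrite [leRHS](_ : _ = 2 * C ^+ 2 * ((D `^ p) ^+ 2
      * (k.+1%:R `^ (delta * p * 2 - 1))^-1)); last by ring.
    rewrite ler_wpM2l ?mulr_ge0 ?sqr_ge0//.
    have h1 : eps k `^ p <= D `^ p * (k.+1%:R `^ (delta * p))^-1.
      rewrite -powRN -mulNr powRrM -powRM ?powR_ge0 ?(ltW D0)//.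
      rewrite ge0_ler_powR ?nnegrE ?(ltW p0) ?(ltW (@param_gt0 _ c a delta c0 a0 k))//.
        by rewrite mulr_ge0 ?powR_ge0// ltW.
      by rewrite powRN epsD.
    apply: (@le_trans _ _ (k%:R * (D `^ p * (k.+1%:R `^ (delta * p))^-1) ^+ 2)).
      rewrite ler_wpM2l// lerXn2r ?nnegrE ?powR_ge0//.
      by rewrite mulr_ge0 ?invr_ge0 ?powR_ge0.
    rewrite exprMn mulrCA ler_wpM2l ?sqr_ge0//.
    have -> : (k.+1%:R `^ (delta * p))^-1 ^+ 2 = (k.+1%:R `^ (delta * p * 2 - 1))^-1
        * k.+1%:R^-1 :> R.
      by rewrite expr2 -powR_split -[in X in _ * X^-1](powRr1 (ler0n R k.+1)) -powR_split;
        congr (_ `^ _)^-1; lra.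
    rewrite mulrCA ler_piMr ?invr_ge0 ?powR_ge0//.
    by rewrite ler_pdivrMr// mul1r ler_nat.
  + exact: cvg_cst.
  + rewrite -[X in _ --> X](addr0 0); apply: cvgD.
      by rewrite -[X in _ --> X](mulr0 (2 * M ^+ 2)); exact: cvgMr.
    rewrite -[X in _ --> X](mulr0 (2 * (C * D `^ p) ^+ 2)); apply: cvgMr.
    exact: powR_cvg0_infty.
- by move=> k; rewrite mul1r.
Qed.

End asymptotics.

(** * The primal-dual algorithm *)

Section objective.
Context {R : realType} {H G : hilbertType R}.

(** The primal objective at an iterate, with [g] evaluated at the selected
    subgradient of its conjugate, differs from the optimal value by pairings of
    the residuals: the two bounds use the subgradients at the iterate and those
    at the solution, respectively. *)
Lemma objective_gap (f : H -> \bar R) (g : G -> \bar R) (m : H -> R) (dm : H -> H)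
    (A : {linear H -> G}) (As : G -> H) x l xif xig xs ls :
  eproper g -> econvex g -> lower_semicontinuous g -> is_adjoint A As ->
  (forall y y', m y + '[dm y, y' - y] <= m y') ->
  subdiff f x xif -> subdiff (fenchel_conj g) l xig ->
  subdiff f xs (- (dm xs + As ls)) -> subdiff (fenchel_conj g) ls (A xs) ->
  exists t : R, (f x + g xig + (m x)%:E - (f xs + g (A xs) + (m xs)%:E))%E = t%:E
    /\ `|t| <= `|xif + As l + dm x| * `|x - xs| + `|xig - A x| * (`|l| + `|ls|).
Proof.
move=> pg cg lg adj m_grad subx subl subxs subls.
rewrite (fenchel_equality pg cg lg subl) (fenchel_equality pg cg lg subls).
rewrite -(fineK subx.1) -(fineK subxs.1) -!EFinD.
eexists; split; first by [].
have h1 := subdiff_ge subx (esym (fineK subx.1)) (esym (fineK subxs.1)).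
have h2 := subdiff_ge subxs (esym (fineK subxs.1)) (esym (fineK subx.1)).
have h3 := subdiff_ge subl (esym (fineK subl.1)) (esym (fineK subls.1)).
have h4 := subdiff_ge subls (esym (fineK subls.1)) (esym (fineK subl.1)).
have h5 := m_grad x xs; have h6 := m_grad xs x.
have h7 : '[xif + As l + dm x, x - xs] <= `|xif + As l + dm x| * `|x - xs|.
  exact: inner_le_norm.
have h8 : '[xig - A x, l] <= `|xig - A x| * `|l| by exact: inner_le_norm.
have h9 : - '[xig - A x, ls] <= `|xig - A x| * `|ls|.
  by rewrite -innerNr -(normrN ls) inner_le_norm.
have h10 := mulr_ge0 (normr_ge0 (xif + As l + dm x)) (normr_ge0 (x - xs)).
have h11 := mulr_ge0 (normr_ge0 (xig - A x)) (normr_ge0 l).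
have h12 := mulr_ge0 (normr_ge0 (xig - A x)) (normr_ge0 ls).
rewrite mulrDr.
move: (`|_| * `|x - xs|) (`|_| * `|l|) (`|_| * `|ls|) h7 h8 h9 h10 h11 h12.
move: (fine (f x)) (fine (f xs)) (fine _) (fine _) h1 h2 h3 h4.
move=> a a' b b' h1 h2 h3 h4 n1 n2 n3.
move: h1 h2 h3 h4 h5 h6.
rewrite !innerDr !innerNr !innerNl !innerDl !innerNl -!(innerC _ (As _)) -!adj.
by rewrite ler_norml => *; apply/andP; split; lra.
Qed.

End objective.

Theorem theorem3p15 (R : realType) (H G : hilbertType R)
  (* smooth data *)
  (h m : H -> R) (dh dm : H -> H) (Lh Lm : R)
  (h_convex : convex_function [set: convex_lmodType H] h)
  (m_convex : convex_function [set: convex_lmodType H] m)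
  (h_grad : is_gradient h dh) (m_grad : is_gradient m dm)
  (dh_cont : continuous dh) (dm_cont : continuous dm)
  (Lh_gt0 : 0 < Lh) (Lm_gt0 : 0 < Lm)
  (dh_lip : Lh.-lipschitz dh) (dm_lip : Lm.-lipschitz dm)
  (* nonsmooth data *)
  (f hhat : H -> \bar R) (g : G -> \bar R)
  (f_proper : eproper f) (f_convex : econvex f) (f_lsc : lower_semicontinuous f)
  (hhat_proper : eproper hhat) (hhat_convex : econvex hhat)
  (hhat_lsc : lower_semicontinuous hhat)
  (g_proper : eproper g) (g_convex : econvex g) (g_lsc : lower_semicontinuous g)
  (* linear operator and its adjoint *)
  (A : {linear H -> G}) (As : G -> H)
  (A_cont : continuous A) (A_adj : is_adjoint A As)
  (* parameters *)
  (c a delta s : R)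
  (c_gt0 : 0 < c) (a_gt0 : 0 < a) (delta_gt0 : 0 < delta)
  (s_gt0 : 0 < s) (s_lt : s < (Num.sqrt 2 * (Lm + opnorm A))^-1)
  (eps : nat -> R := fun k => c / ((k%:R + a) `^ delta))
  (* objects on the product space *)
  (gs := fenchel_conj g)
  (Hval : H -> \bar R := fun x => ((h x)%:E + hhat x)%E)
  (hhatb : H * G -> \bar R := fun z => hhat z.1)
  (Hb : H * G -> \bar R := fun z => Hval z.1)
  (Vb : H * G -> H * G := fun z => (dm z.1 + As z.2, - A z.1))
  (fhatb : H * G -> \bar R := fun z => (f z.1 + gs z.2)%E)
  (Z : set (H * G) := vi_zeros Vb fhatb)
  (sol : set (H * G) := bilevel_sol Vb fhatb Hb)
  (* standing assumptions *)
  (sum_rule : forall k,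
     subdiff (fun z : H * G => fhatb z + (eps k)%:E * hhatb z)%E
     = op_add (subdiff fhatb) (op_scale (eps k) (subdiff hhatb)))
  (qualification : forall zs, sol zs ->
     op_add (subdiff Hb) (normal_cone Z) zs 0)
  (hhatb_bounded : forall S : set (H * G),
     S `<=` [set z | subdiff hhatb z !=set0] -> bounded_set S ->
     bounded_set (\bigcup_(z in S) subdiff hhatb z))
  (* the algorithm *)
  (x xb : nat -> H) (lam lamb : nat -> G)
  (xb_def : forall k, is_prox (fun u => s%:E * (f u + (eps k)%:E * hhat u))%E
     (x k - s *: (dm (x k) + As (lam k) + eps k *: dh (x k))) (xb k))
  (lamb_def : forall k, is_prox (fun u => s%:E * gs u)%E
     (lam k + s *: A (x k)) (lamb k))
  (x_def : forall k, is_prox (fun u => s%:E * (f u + (eps k)%:E * hhat u))%E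
     (x k - s *: (dm (xb k) + As (lamb k) + eps k *: dh (xb k))) (x k.+1))
  (lam_def : forall k, is_prox (fun u => s%:E * gs u)%E
     (lam k + s *: A (xb k)) (lam k.+1))
  (* subgradients selected by the second prox steps *)
  (xif xih : nat -> H) (xig : nat -> G)
  (xif_in : forall k, subdiff f (x k.+1) (xif k.+1))
  (xih_in : forall k, subdiff hhat (x k.+1) (xih k.+1))
  (xig_in : forall k, subdiff gs (lam k.+1) (xig k.+1))
  (xifh_def : forall k,
     s^-1 *: (x k - x k.+1
              - s *: (dm (xb k) + As (lamb k) + eps k *: dh (xb k)))
     = xif k.+1 + eps k *: xih k.+1)
  (xig_def : forall k,
     s^-1 *: (lam k - lam k.+1 + s *: A (xb k)) = xig k.+1)
  (* an optimal solution *)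
  (xs : H) (ls : G) (zs_sol : sol (xs, ls))
  (r : nat -> R^o := fun k => `|xif k + As (lam k) + dm (x k)|)
  (d : nat -> R^o := fun k => `|xig k - A (x k)|)
  (e : nat -> \bar R := fun k =>
     `|f (x k) + g (xig k) + (m (x k))%:E
       - (f xs + g (A xs) + (m xs)%:E)|%E)
  (inv_sqrt : nat -> R^o := fun k => (Num.sqrt k%:R)^-1)
  (inv_pow : R -> nat -> R^o := fun p k => (k%:R `^ p)^-1) :
  (forall k, (1 <= k)%N ->
     (idist 0%R [set (p + As (lam k) + dm (x k))%R | p in subdiff f (x k)]
        <= (r k)%:E)%E
     /\ (idist 0%R [set (q - A (x k))%R | q in subdiff gs (lam k)] <= (d k)%:E)%E)
  /\
  (attouch_czarnecki Vb fhatb Hb eps -> 2^-1 < delta ->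
     [/\ r =o_\oo inv_sqrt, d =o_\oo inv_sqrt & elittleo e inv_sqrt])
  /\
  (attouch_czarnecki Vb fhatb Hb eps -> delta = 2^-1 ->
     [/\ r =O_\oo inv_sqrt, d =O_\oo inv_sqrt & ebigO e inv_sqrt]
     /\ Hval (x k) @[k --> \oo] --> Hval xs
     /\ exists2 zinf : H * G, sol zinf & weak_cvg (fun k => (x k, lam k)) zinf)
  /\
  (forall rho rhos : R, 1 < rho < 2 -> rho^-1 + rhos^-1 = 1 ->
     sharpness Vb fhatb Hb rho -> rhos^-1 < delta < 2^-1 ->
     [/\ r =O_\oo inv_pow delta, d =O_\oo inv_pow delta
       & ebigO e (inv_pow delta)]
     /\ elittleo (fun k => `|Hval (x k) - Hval xs|%E) (inv_pow (2^-1 - delta))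
     /\ exists2 zinf : H * G, sol zinf & weak_cvg (fun k => (x k, lam k)) zinf).
Proof.
pose L := Lm + opnorm A.
have opA0 : 0 <= opnorm A by exact: opnorm_ge0.
have L0 : 0 < L by rewrite ltr_pwDl.
have sL : s * L < 1.
  have sq1 : 1 <= Num.sqrt 2 :> R by rewrite -[leLHS]sqrtr1 ler_sqrt ?ler1n.
  have sq0 : 0 < Num.sqrt 2 * L :> R by rewrite mulr_gt0// sqrtr_gt0.
  have : s * (Num.sqrt 2 * L) < 1 by rewrite -ltr_pdivlMr// div1r.
  by apply: le_lt_trans; rewrite ler_wpM2l ?(ltW s_gt0)// ler_peMl// ltW.
have m_ineq y y' : m y + '[dm y, y' - y] <= m y'.
  exact: gradient_ineq m_convex m_grad.
have h_ineq y y' : h y + '[dh y, y' - y] <= h y'.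
  exact: gradient_ineq h_convex h_grad.
have dm_mono y y' : 0 <= '[dm y - dm y', y - y'].
  by have := m_ineq y y'; have := m_ineq y' y; rewrite !innerE; lra.
have dm_lip' y y' : `|dm y - dm y'| <= Lm * `|y - y'| by exact: (dm_lip (y, y')).
have dh_lip' y y' : `|dh y - dh y'| <= Lh * `|y - y'| by exact: (dh_lip (y, y')).
have gsN l : gs l != -oo%E by exact: fenchel_conj_gtNy.
have gs_cvx : econvex gs by exact: fenchel_conj_convex.
have eps0 k : 0 < eps k by exact: param_gt0.
have eps_cvg : eps k @[k --> \oo] --> (0 : R) by exact: param_cvg0.
pose Db (u : H * G) : H * G := (dh u.1, 0).
pose z k : H * G := (x k, lam k); pose zb k : H * G := (xb k, lamb k).
pose xi k : H * G := (xif k, xig k); pose eta k : H * G := (xih k, 0).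
pose zetab k : H * G :=
  (s^-1 *: (x k - s *: (dm (x k) + As (lam k) + eps k *: dh (x k)) - xb k),
   s^-1 *: (lam k + s *: A (x k) - lamb k)).
pose q := (1 + s * L) / 2.
have sL0 : 0 < s * L by rewrite mulr_gt0.
have q0 : 0 < q by rewrite /q; lra.
have q1 : q < 1 by rewrite /q; lra.
have Db_lip u v : inorm (Db u - Db v) <= Lh * inorm (u - v).
  have -> : Db u - Db v = (dh u.1 - dh v.1, 0) by apply/pair_equal_spec; rewrite /= subrr.
  rewrite inorm_inl; apply: le_trans (dh_lip' _ _) _.
  by rewrite ler_wpM2l ?(ltW Lh_gt0)// (inorm_fst (u - v)).
(* From [N] on the regularisation leaves [s] times the Lipschitz constant of the
   step operator below [q]. *)
have [N _ epsN] : \forall k \near \oo, s * (eps k * Lh) <= (1 - s * L) / 2.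
  have e0 : 0 < (1 - s * L) / 2 / (s * Lh).
    by rewrite !divr_gt0 ?mulr_gt0//; lra.
  move/cvgrPdist_le : eps_cvg => /(_ _ e0); apply: filterS => k.
  rewrite sub0r normrN gtr0_norm// ler_pdivlMr ?mulr_gt0//.
  by rewrite mulrCA.
have T_lip k u v : (maxn N 1 <= k)%N ->
    s ^+ 2 * '[Vb u + eps k *: Db u - (Vb v + eps k *: Db v),
               Vb u + eps k *: Db u - (Vb v + eps k *: Db v)]
    <= q ^+ 2 * '[u - v, u - v].
  rewrite geq_max => /andP[/epsN/= hk _].
  rewrite -!sqr_inorm -!exprMn lerXn2r ?nnegrE
    ?(mulr_ge0 (ltW s_gt0)) ?(mulr_ge0 (ltW q0)) ?inorm_ge0//.
  rewrite opprD addrACA -scalerBr.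
  apply: (@le_trans _ _ (s * (L * inorm (u - v) + eps k * (Lh * inorm (u - v))))).
    rewrite ler_wpM2l ?(ltW s_gt0)//; apply: le_trans (ler_inormD _ _) _.
    apply: lerD; first exact: (pd_operator_lip A_cont A_adj (ltW Lm_gt0) dm_lip').
    by rewrite inormZ gtr0_norm// ler_wpM2l// ltW.
  have := ler_wpM2r (inorm_ge0 (u - v)) hk.
  by rewrite /q; move: (inorm (u - v)) => t; lra.
have zb_def k : zb k = z k - s *: (Vb (z k) + eps k *: Db (z k) + zetab k).
  apply/pair_equal_spec; split=> /=.
    rewrite scalerDr opprD addrA scalerA mulfV ?gt_eqF// scale1r opprB.
    by rewrite addrC subrK.
  rewrite scaler0 addr0 scalerDr opprD addrA scalerA mulfV ?gt_eqF// scale1r opprB.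
  by rewrite scalerN opprK addrC subrK.
have z_def k : z k.+1 = z k
    - s *: (Vb (zb k) + eps k *: Db (zb k) + (xi k.+1 + eps k *: eta k.+1)).
  apply/pair_equal_spec; split=> /=.
    rewrite -xifh_def scalerDr opprD addrA scalerA mulfV ?gt_eqF// scale1r.
    by rewrite opprB addrA subrK opprB addrC subrK.
  rewrite !scaler0 !addr0 -xig_def scalerDr opprD addrA scalerA mulfV ?gt_eqF// scale1r.
  by rewrite scalerN opprK opprD opprB addrACA subrr addr0 addrC subrK.
(* The proximal subproblem of the product decouples into the two given ones. *)
have zetab_in k : subdiff (fun u => fhatb u + (eps k)%:E * hhatb u)%E (zb k) (zetab k).
  have -> : (fun u => fhatb u + (eps k)%:E * hhatb u)%E
      = (fun u : H * G => (f u.1 + (eps k)%:E * hhat u.1) + gs u.2)%E.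
    by apply/funext => u; rewrite /fhatb /hhatb addeAC.
  have fhN u : (f u + (eps k)%:E * hhat u)%E != -oo%E.
    rewrite adde_eq_ninfty negb_or f_proper.1/=.
    by rewrite mule_gtNy ?(ltW (eps0 k))// hhat_proper.1.
  apply: (@subdiff_prod _ _ _ (fun u => f u + (eps k)%:E * hhat u)%E gs).
    apply: (@is_prox_subdiff _ _ _ s _ _ (x k.+1)) => //.
    + by apply: econvexD => //; [exact: f_proper.1|exact: hhat_proper.1].
    + by rewrite fin_numD (xif_in k).1 fin_numM// (xih_in k).1.
  apply: (@is_prox_subdiff _ _ _ s _ _ (lam k.+1)) => //.
  exact: (xig_in k).1.
have xi_in k : subdiff fhatb (z k.+1) (xi k.+1) by exact: (@subdiff_prod _ _ _ f gs).
have eta_in k : subdiff hhatb (z k.+1) (eta k.+1).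
  have [hx sub] := xih_in k; split=> // u.
  by rewrite prod_innerE /= inner0l addr0.
have eta_bounded (M : R) : (forall k, inorm (z k) <= M) ->
    exists G1 : R, forall k, inorm (eta k.+1) <= G1.
  move=> zM; have := hhatb_bounded [set z k.+1 | k in setT].
  case=> [_ [k _ <-]||].
  - by exists (eta k.+1); exact: eta_in.
  - exists M; split; first exact: num_real.
    move=> y My _ [k _ <-]; apply: le_trans (ltW My); apply: le_trans (zM k.+1).
    by rewrite ge_max (inorm_fst (z k.+1)) (inorm_snd (z k.+1)).
  - move=> b [_ /(_ (b + 1))]; rewrite ltrDl ltr01 => /(_ isT) hb.
    exists (b + 1) => k; rewrite inorm_inl.
    have : (\bigcup_(u in [set z k.+1 | k in setT]) subdiff hhatb u) (eta k.+1).
      by exists (z k.+1); [exists k|exact: eta_in].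
    move=> /hb; apply: le_trans.
    by rewrite -[leRHS]/(Num.max `|xih k.+1| `|0 : G|) le_max lexx.
have [Zzs _] := zs_sol; move/vi_zerosP : Zzs.
rewrite -[(- _)]/(- (dm xs + As ls), - - A xs) opprK => /subdiff_prod_inv[]//.
  exact: f_proper.1.
move=> subxs subls.
pose res k := Vb (z k.+1) + xi k.+1.
have r_le k : `|r k.+1| <= 1 * inorm (res k).
  rewrite mul1r normr_id /r.
  have -> : xif k.+1 + As (lam k.+1) + dm (x k.+1) = (res k).1.
    by rewrite addrC (addrC (xif _)) addrA.
  exact: inorm_fst.
have d_le k : `|d k.+1| <= 1 * inorm (res k).
  rewrite mul1r normr_id /d.
  have -> : xig k.+1 - A (x k.+1) = (res k).2 by rewrite addrC.
  exact: inorm_snd.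
have fhN u : fhatb u != -oo%E.
  by rewrite adde_eq_ninfty negb_or f_proper.1/= gsN.
have hhN u : hhatb u != -oo%E by exact: hhat_proper.1.
have fh_cvx : econvex fhatb by exact: econvex_prod f_proper.1 gsN f_convex gs_cvx.
have sup_f : sup_affine f by move=> u t; exact: affine_minorant.
have sup_hhat : sup_affine hhat by move=> u t; exact: affine_minorant.
have sup_gs : sup_affine gs by move=> u t; exact: fenchel_conj_minorant.
have sup_fh : sup_affine fhatb by exact: sup_affine_prod f_proper.1 gsN sup_f sup_gs.
have sup_hh : sup_affine hhatb by exact: sup_affine_fst.
have hh_grad u v : h u.1 + '[Db u, v - u] <= h v.1.
  by rewrite prod_innerE /= inner0l addr0; exact: h_ineq.
have rates := bilevel_rates s_gt0 q0 q1 eps0 (param_dec c_gt0 a_gt0 delta_gt0)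
  fhN hhN (pd_operator_mono A_adj dm_mono) hh_grad T_lip xi_in eta_in zetab_in
  zb_def z_def qualification fh_cvx sup_fh sup_hh
  (riesz_space_prod (@riesz_space_hilbert _ H) (@riesz_space_hilbert _ G))
  (pd_operator_lip A_cont A_adj (ltW Lm_gt0) dm_lip') Db_lip eta_bounded
  (param_convex c_gt0 a_gt0 delta_gt0) eps_cvg _ zs_sol.
have Hval_fin k : Hval (x k.+1) = (h (x k.+1) + fine (hhat (x k.+1)))%:E.
  by rewrite EFinD fineK// (xih_in k).1.
have hs_fin : hhat xs \is a fin_num.
  have [p [+ _] _] := qualification _ zs_sol; rewrite /Hb /Hval /=.
  by have := hhat_proper.1 xs; case: (hhat xs).
have Hval_xs : Hval xs = (h xs + fine (hhat xs))%:E by rewrite EFinD fineK.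
have e_le (M : R) : (forall k, inorm (z k.+1 - (xs, ls)) <= M) -> 0 <= M ->
    exists2 C : R, 0 <= C &
      forall k, e k.+1 = (fine (e k.+1))%:E /\ `|fine (e k.+1)| <= C * inorm (res k).
  move=> zM M0; exists (M + (M + `|ls| + `|ls|)); first by rewrite !addr_ge0.
  move=> k; have [t [tE t_le]] := objective_gap g_proper g_convex g_lsc A_adj m_ineq
    (xif_in k) (xig_in k) subxs subls.
  rewrite /e tE /= normr_id; split=> //; apply: le_trans t_le _.
  have zx : `|x k.+1 - xs| <= M.
    exact: le_trans (inorm_fst (z k.+1 - (xs, ls))) (zM k).
  have zl : `|lam k.+1| <= M + `|ls|.
    rewrite -{1}(subrK ls (lam k.+1)); apply: le_trans (ler_normD _ _) _.
    rewrite lerD2r.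
    exact: le_trans (inorm_snd (z k.+1 - (xs, ls))) (zM k).
  have := r_le k; have := d_le k; rewrite !mul1r !normr_id /r /d => hd hr.
  rewrite [leRHS]mulrDl; apply: lerD; rewrite [leRHS]mulrC ler_pM ?addr_ge0//.
  by rewrite lerD2r.
have e_fin C : (forall k, e k.+1 = (fine (e k.+1))%:E /\ `|fine (e k.+1)| <= C k) ->
    \forall k \near \oo, e k = (fine (e k))%:E.
  by move=> eC; apply: near_inftyS; apply: nearW => k; have [] := eC k.
(* Slow decay of the parameters, under either growth condition. *)
have low : delta <= 2^-1 ->
    attouch_czarnecki Vb fhatb Hb eps \/ (exists rho : R,
       [/\ 1 < rho, sharpness Vb fhatb Hb rho
         & bounded_sums (maxn N 1) (fun k => eps k `^ (rho / (rho - 1)))]) ->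
    [/\ r =O_\oo inv_pow delta, d =O_\oo inv_pow delta & ebigO e (inv_pow delta)]
    /\ h (x k.+1) + fine (hhat (x k.+1)) @[k --> \oo] --> h xs + fine (hhat xs)
    /\ exists2 zinf : H * G, sol zinf & weak_cvg (fun k => (x k, lam k)) zinf.
  move=> d2 /rates[M [w [M0 [zM w0 kw resw excess] _ weak]]].
  have [C C0 eC] := e_le M zM M0.
  split.
    split; [| |exists (fun k => fine (e k)); split; first exact: e_fin eC].
    - exact: (residual_bigO c_gt0 a_gt0 delta_gt0 w0 kw M0 ler01 d2 resw r_le).
    - exact: (residual_bigO c_gt0 a_gt0 delta_gt0 w0 kw M0 ler01 d2 resw d_le).
    - apply: (residual_bigO c_gt0 a_gt0 delta_gt0 w0 kw M0 C0 d2 resw) => k.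
      by have [] := eC k.
  (* [(k.+1) `^ (2^-1 - delta) >= 1] makes the rate of the excess a bound by
     [e']. *)
  apply: weak => e' e'0.
  have := value_excess_small c_gt0 a_gt0 delta_gt0 w0 kw M0 e'0 excess.
  apply: filterS => k /= hk; rewrite -lerBlDl; apply: le_trans hk _.
  rewrite ler_piMr ?(ltW e'0)// invf_le1 ?powR_gt0//.
  rewrite -[leLHS](powRr0 k.+1%:R) ler_powR ?ler1n// subr_ge0.
  exact: d2.
split; [|split; [|split]].
- move=> [//|k] _; split; apply: ereal_inf_lbound.
    exists (xif k.+1 + As (lam k.+1) + dm (x k.+1)); first by exists (xif k.+1).
    by rewrite sub0r inormN inorm_norm.
  exists (xig k.+1 - A (x k.+1)); first by exists (xig k.+1).
  by rewrite sub0r inormN inorm_norm.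
- move=> ac d2; have [M [w [M0 [zM w0 kw resw _] _ _]]] := rates (or_introl ac).
  have [C C0 eC] := e_le M zM M0; rewrite /inv_sqrt inv_sqrtE.
  split; [| |exists (fun k => fine (e k)); split; first exact: e_fin eC].
  + exact: (residual_littleo c_gt0 a_gt0 delta_gt0 w0 kw M0 ler01 d2 resw r_le).
  + exact: (residual_littleo c_gt0 a_gt0 delta_gt0 w0 kw M0 ler01 d2 resw d_le).
  + apply: (residual_littleo c_gt0 a_gt0 delta_gt0 w0 kw M0 C0 d2 resw) => k.
    by have [] := eC k.
- move=> ac d2; have d2' : delta <= 2^-1 by rewrite d2.
  have [big [Hcvg weak]] := low d2' (or_introl ac).
  split; [|split=> //].
    by rewrite /inv_sqrt inv_sqrtE; move: big; rewrite /inv_pow d2.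
  rewrite -(cvg_shiftS (fun k => Hval (x k))) Hval_xs.
  under eq_fun do rewrite Hval_fin.
  by apply: cvg_EFin => //; exact: nearW.
- move=> rho rhos /andP[rho1 rho2] conj sh /andP[d1 d2].
  (* [rho / (rho - 1)] is the conjugate exponent [rhos]. *)
  have dp : 1 < delta * (rho / (rho - 1)).
    have r0 : 0 < rho - 1 by rewrite subr_gt0.
    have rhosE : rhos^-1 = (rho - 1) / rho.
      by rewrite mulrBl mulfV ?gt_eqF ?(lt_trans ltr01)// mul1r -conj addrC addKr.
    move: d1; rewrite rhosE ltr_pdivrMr ?(lt_trans ltr01)// => d1.
    by rewrite mulrA ltr_pdivlMr// mul1r.
  have K0 : (0 < maxn N 1)%N by rewrite leq_max orbT.
  have gc : exists rho : R, [/\ 1 < rho, sharpness Vb fhatb Hb rho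
      & bounded_sums (maxn N 1) (fun k => eps k `^ (rho / (rho - 1)))].
    exists rho; split=> //; exact: (bounded_sums_param c_gt0 a_gt0 delta_gt0 K0 dp).
  have [big [_ weak]] := low (ltW d2) (or_intror gc).
  split=> //; split=> //.
  have [M [w [M0 [zM w0 kw resw excess] deficit _]]] := rates (or_intror gc).
  have [C C0 hC] := deficit rho rho1 sh.
  exists (fun k => fine `|Hval (x k) - Hval xs|%E); split.
    apply: near_inftyS; apply: nearW => k.
    by rewrite Hval_fin Hval_xs.
  apply: littleo_shift => e' e'0.
  have := value_excess_small c_gt0 a_gt0 delta_gt0 w0 kw M0 e'0 excess.
  have := value_deficit_small c_gt0 a_gt0 delta_gt0 w0 kw M0 C0 e'0 dp hC.
  apply: filterS2 => k /= h1 h2.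
  rewrite inv_powR_norm Hval_fin Hval_xs /= normr_id ler_norml.
  by apply/andP; split; lra.
Qed.
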